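(* Let $d\ge 1$, $M>0$ and $\delta>0$. There exists a constant $C_0=C_0(\delta,M,d)>0$ such that for all probability measures $\pi$ and $\eta$ supported on the cube $[-M,M]^d$, $$H(f_\pi,f_\eta)\le\Big(C_0\vee \mathrm{TV}(f_\pi,f_\eta)^{-\alpha(\mathrm{TV}(f_\pi,f_\eta))}\Big)\,\mathrm{TV}(f_\pi,f_\eta),$$ where, for $t>0$, $$\alpha(t):=\frac{2+\delta}{\log\big(\log(1/t)\vee e\big)}.$$
   Context: For a probability measure $\pi$ on $\mathbb R^d$, $f_\pi(x):=\int_{\mathbb R^d}\phi_d(x-\theta)\,d\pi(\theta)$ is the Gaussian location mixture density, where $\phi_d(x)=(2\pi)^{-d/2}\exp(-\|x\|_2^2/2)$. For densities $p,q$ on $\mathbb R^d$: $\mathrm{TV}(p,q)=\frac12\int|p-q|$ and $H(p,q)=\sqrt{\frac12\int(\sqrt p-\sqrt q)^2}$. $a\vee b=\max\{a,b\}$. When $\mathrm{TV}(f_\pi,f_\eta)=0$ the right-hand side is read as $0$. *)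

(* Defs.v *)
From HB Require Import structures.
From mathcomp Require Import all_boot all_order all_algebra.
From mathcomp Require Import all_classical all_reals all_analysis.

Set Implicit Arguments.
Unset Strict Implicit.
Unset Printing Implicit Defensive.

Import Order.TTheory GRing.Theory Num.Theory.
Import numFieldNormedType.Exports.

Local Open Scope classical_set_scope.
Local Open Scope ring_scope.

(* R^d is d.-tuple R, with the product (Borel) sigma-algebra of the library;
   d-dimensional Lebesgue measure is the iterated product of lebesgue_measure,
   transported along (x, y) |-> x :: y. *)
Section lebesgue_tuple_succ.
Context {R : realType} {n : nat}.
Variable mu : {sigma_finite_measure set (n.-tuple R) -> \bar R}.

Definition cons_pair (z : measurableTypeR R * n.-tuple R) : n.+1.-tuple R :=
  [tuple of z.1 :: z.2].

Lemma measurable_cons_pair : measurable_fun [set: _] cons_pair.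
Proof. by apply: (@measurable_cons _ _ _ _ (fst : _ -> R) _ snd). Qed.

Definition lebesgue_tuple_succ : set (n.+1.-tuple R) -> \bar R :=
  pushforward (@lebesgue_measure R \x mu)%E cons_pair.

#[local] Hint Resolve measurable_cons_pair : core.

Let succ0 : lebesgue_tuple_succ set0 = 0%E.
Proof. exact: measure0. Qed.

Let succ_ge0 A : (0 <= lebesgue_tuple_succ A)%E.
Proof. exact: measure_ge0. Qed.

Let succ_sigma_additive : semi_sigma_additive lebesgue_tuple_succ.
Proof. exact: measure_semi_sigma_additive. Qed.

HB.instance Definition _ := isMeasure.Build _ _ _ lebesgue_tuple_succ
  succ0 succ_ge0 succ_sigma_additive.

Let behead_cons_pair (a : R) (y : n.-tuple R) :
  [tuple of behead (cons_pair (a, y))] = y.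
Proof. exact: val_inj. Qed.

Lemma lebesgue_tuple_succE (A : set R) (B : set (n.-tuple R)) :
  measurable A -> measurable B ->
  lebesgue_tuple_succ [set x | A (thead x) /\ B [tuple of behead x]] =
  (@lebesgue_measure R A * mu B)%E.
Proof.
move=> mA mB; rewrite -product_measure1E// /lebesgue_tuple_succ /pushforward.
congr (product_measure1 _ _ _); apply/seteqP.
by split=> -[a y] /=; rewrite behead_cons_pair.
Qed.

Let succ_sigma_finite : sigma_finite [set: _] lebesgue_tuple_succ.
Proof.
have /sigma_finiteP[F [FT ndF Ffin]] := sigma_finiteT (@lebesgue_measure R).
have /sigma_finiteP[G [GT ndG Gfin]] := sigma_finiteT mu.
exists (fun k => [set x | F k (thead x) /\ G k [tuple of behead x]]).
  apply/esym/seteqP; split=> // x _.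
  have [i _ Fi] : (\bigcup_i F i) (thead x) by rewrite -FT.
  have [j _ Gj] : (\bigcup_i G i) [tuple of behead x] by rewrite -GT.
  exists (maxn i j) => //; split.
    by move: Fi; apply/subsetPset/ndF/leq_maxl.
  by move: Gj; apply/subsetPset/ndG/leq_maxr.
move=> k; have [mF Foo] := Ffin k; have [mG Goo] := Gfin k; split.
  apply: measurableI; rewrite -[X in measurable X]setTI.
    exact: measurable_tnth.
  exact: measurable_behead.
by rewrite lebesgue_tuple_succE// lte_mul_pinfty// ge0_fin_numE.
Qed.

HB.instance Definition _ := @Measure_isSigmaFinite.Build _ _ _
  lebesgue_tuple_succ succ_sigma_finite.

End lebesgue_tuple_succ.

Fixpoint lebesgue_tuple {R : realType} (d : nat) :
    {sigma_finite_measure set (d.-tuple R) -> \bar R} :=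
  match d with
  | 0 => dirac [tuple]
  | n.+1 => lebesgue_tuple_succ (lebesgue_tuple n)
  end.

Lemma lebesgue_tuple_box (R : realType) (d : nat) (A : 'I_d -> set R) :
  (forall i, measurable (A i)) ->
  lebesgue_tuple d [set x | forall i, A i (tnth x i)] =
  (\prod_(i < d) @lebesgue_measure R (A i))%E.
Proof.
elim: d A => [|n IH] A mA.
  by rewrite big_ord0 /= diracE mem_set//= => -[].
rewrite big_ord_recl /= -IH// -lebesgue_tuple_succE//; last first.
  rewrite (_ : mkset _ =
      \bigcap_(i in [set: 'I_n]) ((@tnth n R ^~ i) @^-1` A (lift ord0 i))).
    apply: fin_bigcap_measurable => // i _; rewrite -[X in measurable X]setTI.
    exact: measurable_tnth.
  by apply/seteqP; split=> x /= Hx i => [_|]; exact: Hx.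
congr lebesgue_tuple_succ; apply/seteqP; split=> x /=.
  by move=> xA; split=> [|i]; [exact: xA|rewrite -(tnthS (thead x)) -tuple_eta].
case=> x0A xA i; have [j ->|->//] := unliftP ord0 i.
by rewrite [x]tuple_eta tnthS.
Qed.

Section gaussian_mixture.
Context {R : realType} {d : nat}.

Definition norm2 (x : d.-tuple R) : R :=
  Num.sqrt (\sum_(i < d) tnth x i ^+ 2).

Definition sub_tuple (x y : d.-tuple R) : d.-tuple R :=
  [tuple tnth x i - tnth y i | i < d].

Definition std_gauss_pdf (x : d.-tuple R) : R :=
  (2 * pi) `^ (- (d%:R / 2)) * expR (- (norm2 x ^+ 2 / 2)).

Definition gauss_mixture (P : probability (d.-tuple R) R) (x : d.-tuple R) : R :=
  \int[P]_theta std_gauss_pdf (sub_tuple x theta).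

(* The integrals below are real-valued (Rintegral); they are finite whenever p
   and q are probability densities. *)
Definition TV (p q : d.-tuple R -> R) : R :=
  2^-1 * \int[lebesgue_tuple d]_x `|p x - q x|.

Definition hellinger (p q : d.-tuple R -> R) : R :=
  Num.sqrt
    (2^-1 * \int[lebesgue_tuple d]_x (Num.sqrt (p x) - Num.sqrt (q x)) ^+ 2).

Definition cube (M : R) : set (d.-tuple R) :=
  [set x | forall i, tnth x i \in `[- M, M]].

Definition supported_on (P : probability (d.-tuple R) R) (A : set (d.-tuple R)) :=
  P A = 1%E.

End gaussian_mixture.

(* Meant for t > 0: at t = 0 the inverse and the logarithm take default values,
   and the bound in which alpha occurs vanishes, having t as a factor. *)
Definition alpha {R : realType} (delta t : R) : R :=
  (2 + delta) / ln (Num.max (ln t^-1) (expR 1)).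

(* Main.v *)
(* Write f_pi - f_eta = phi * g, where phi is the standard Gaussian density and
   g(x) = \int exp(x.u - |u|^2/2) d(pi - eta)(u).  In the Hermite basis, g has the
   moment tensors m_n of pi - eta as coefficients, with
   \int g^2 phi = \sum_n |m_n|^2 / n! =: E(1).  Set E(s) = \sum_n s^n |m_n|^2 / n! and
   let g_r, with r < 1 close to 1, be g with its degree n part multiplied by r^n.

   Since both mixtures are bounded below by a multiple of phi(x) exp(-M |x|_1), H^2 is at
   most a constant times E(1/r).  On the other hand E(r) = \int g_r (f_pi - f_eta),
   while Mehler's kernel and Cauchy-Schwarz give
   |g_r(x)|^2 <= C E(r) exp(|x|^2/2).  As the moments are bounded, E(1/r) and E(r) are
   comparable up to r^(-2N) and a Taylor remainder of order K^N/N!.  Cutting the integral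
   at |x|^2 = R^2 with R^2 about 4N, where the Gaussian tail beats r^(-2N), yields
   H <= A exp((1 + o(1)) N) TV + B sqrt(K^N / N!) for every N, and
   N ~ 2 log(1/TV) / log log(1/TV) is the optimal degree. *)

Require Import Defs.
From mathcomp Require Import all_boot all_order all_algebra.
From mathcomp Require Import all_classical all_reals all_analysis.
From mathcomp Require Import measurable_realfun ring lra.
Set Implicit Arguments.
Unset Strict Implicit.
Unset Printing Implicit Defensive.
Import Order.TTheory GRing.Theory Num.Theory.
Import numFieldNormedType.Exports.
Local Open Scope classical_set_scope.
Local Open Scope ring_scope.

(** * Gaussian integrals and product integrands on tuples *)

(** Completing the square exhibits the integrand as a multiple of the normal density with mean
    [a / c] and variance [c^-1]. *)
Lemma integral_gauss_1d (R : realType) (a c : R) : 0 < c ->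
  (\int[lebesgue_measure]_y (expR (a * y - c / 2 * y ^+ 2))%:E =
   (Num.sqrt (2 * pi / c) * expR (a ^+ 2 / (2 * c)))%:E)%E.
Proof.
move=> c0; pose s := Num.sqrt c^-1.
have s0 : s != 0 by rewrite gt_eqF// sqrtr_gt0 invr_gt0.
have s2 : s ^+ 2 = c^-1 by rewrite sqr_sqrtr// invr_ge0 ltW.
have p0 := normal_peak_gt0 s0.
transitivity (\int[lebesgue_measure]_y
   (((normal_peak s)^-1 * expR (a ^+ 2 / (2 * c)))%:E *
     (normal_pdf (a / c) s y)%:E))%E.
  apply: eq_integral => y _; rewrite normal_pdfE// -EFinM; congr EFin.
  rewrite [RHS]mulrACA mulVf ?gt_eqF// mul1r /normal_fun -expRD; congr expR.
  by rewrite s2 -mulr_natr; field; rewrite gt_eqF.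
rewrite integralZl//; last exact: integrable_normal_pdf.
rewrite integral_normal_pdf mule1 /normal_peak invrK s2; congr (Num.sqrt _ * _)%:E.
by rewrite -mulr_natr; field; rewrite gt_eqF.
Qed.

(** Induction on [d]: the measure is a pushforward of a product measure, so Tonelli splits off the
    first coordinate. *)
Lemma integral_lebesgue_tuple_prod (R : realType) (d : nat) (f : 'I_d -> R -> R) :
  (forall i, measurable_fun setT (f i)) -> (forall i x, 0 <= f i x) ->
  (\int[lebesgue_tuple d]_x (\prod_(i < d) f i (tnth x i))%:E =
   \prod_(i < d) \int[@lebesgue_measure R]_y (f i y)%:E)%E.
Proof.
have mprod k (g : 'I_k -> R -> R) : (forall i, measurable_fun setT (g i)) ->
    measurable_fun setT (fun x : k.-tuple R => \prod_(i < k) g i (tnth x i)).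
  move=> mg; apply: measurable_prod => i _.
  by apply: measurableT_comp; [exact: mg | exact: measurable_tnth].
elim: d f => [|d IH] f mf f0.
  rewrite /= integral_dirac//=; last by apply/measurable_EFinP; exact: mprod.
  by rewrite !big_ord0 diracT mul1e.
rewrite /= [LHS]ge0_integral_pushforward//=; last 3 first.
- exact: measurable_cons_pair.
- by apply/measurable_EFinP; exact: mprod.
- by move=> y _; rewrite lee_fin prodr_ge0.
rewrite preimage_setT.
under eq_integral do rewrite /= big_ord_recl /=.
have mt := mprod d (fun i => f (lift ord0 i)) (fun i => mf (lift ord0 i)).
have mpair : measurable_fun setT (fun z : measurableTypeR R * d.-tuple R =>
    f ord0 z.1 * \prod_(i < d) f (lift ord0 i) (tnth z.2 i)).
  apply: measurable_funM; first exact: (measurableT_comp (mf ord0) measurable_fst).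
  exact: (measurableT_comp mt measurable_snd).
transitivity (\int[@lebesgue_measure R \x lebesgue_tuple d]_z
   (f ord0 z.1 * \prod_(i < d) f (lift ord0 i) (tnth z.2 i))%:E)%E.
  apply: eq_integral => z _; congr (_ * _)%:E; apply: eq_bigr => i _.
  by rewrite (tnth_nth 0) /= -tnth_nth.
rewrite fubini_tonelli1/=; last 2 first.
- exact/measurable_EFinP.
- by move=> z; rewrite lee_fin mulr_ge0// prodr_ge0.
rewrite big_ord_recl /fubini_F/= -IH//.
under eq_integral.
  move=> x _; under eq_integral do rewrite EFinM.
  rewrite ge0_integralZl_EFin//; last 2 first.
  - by move=> z _; rewrite lee_fin prodr_ge0.
  - by apply/measurable_EFinP; exact: mt.
  over.
rewrite ge0_integralZr//.
- by apply/measurable_EFinP; exact: (mf ord0).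
- by move=> x _; rewrite lee_fin.
- by apply: integral_ge0 => z _; rewrite lee_fin prodr_ge0.
Qed.

(** * Fubini for a family dominated uniformly in the second variable *)

Section dominated_fubini.
Context d1 d2 (T1 : measurableType d1) (T2 : measurableType d2) (R : realType).
Variables (m : {sigma_finite_measure set T1 -> \bar R}) (P : probability T2 R).
Variables (f : T1 * T2 -> R) (h : T1 -> R).
Hypotheses (mf : measurable_fun setT f) (fh : forall x y, `|f (x, y)| <= h x).
Hypothesis ih : m.-integrable setT (EFin \o h).

Lemma integrable_dominated_section1 x : P.-integrable setT (EFin \o (fun y => f (x, y))).
Proof.
have mfx : measurable_fun setT (fun y => f (x, y)).
  exact: (measurableT_comp mf (measurable_pair1 x)).
apply: (le_integrable measurableT _ _ (finite_measure_integrable_cst P (h x) measurableT)).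
  exact/measurable_EFinP.
by move=> y _ /=; rewrite lee_fin (le_trans (fh x y))// ler_norm.
Qed.

Lemma integrable_dominated_section2 y : m.-integrable setT (EFin \o (fun x => f (x, y))).
Proof.
have mfx : measurable_fun setT (fun x => f (x, y)).
  exact: (measurableT_comp mf (measurable_pair2 y)).
apply: (le_integrable measurableT _ _ ih); first exact/measurable_EFinP.
by move=> x _ /=; rewrite lee_fin (le_trans (fh x y))// ler_norm.
Qed.

Let EFin1 x : (\int[P]_y f (x, y))%:E = (\int[P]_y (f (x, y))%:E)%E.
Proof. by rewrite fineK// integrable_fin_num//; exact: integrable_dominated_section1. Qed.

Let EFin2 y : (\int[m]_x f (x, y))%:E = (\int[m]_x (f (x, y))%:E)%E.
Proof. by rewrite fineK// integrable_fin_num//; exact: integrable_dominated_section2. Qed.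

(** Since [P] has mass one, the inner integral of [|f|] is at most [h x], and Tonelli reduces the
    claim to the integrability of [h]. *)
Lemma integrable_dominated_prod : (m \x P)%E.-integrable setT (EFin \o f).
Proof.
apply/integrable12ltyP; first exact/measurable_EFinP.
apply: (@le_lt_trans _ _ (\int[m]_x `|(h x)%:E|)%E); last by case/integrableP : ih.
apply: ge0_le_integral => //.
- by move=> x _; exact: integral_ge0.
- apply: (measurable_fun_fubini_tonelli_F (fun z => `|(f z)%:E|)%E) => //.
  by apply: measurableT_comp => //; exact/measurable_EFinP.
- by apply: measurableT_comp => //; exact: (measurable_int m).
- move=> x _.
  apply: (@le_trans _ _ (\int[P]_y `|(h x)%:E|)%E); last first.
    by rewrite integral_cst// [X in (_ * X)%E](@probability_setT _ _ _ P) mule1.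
  apply: ge0_le_integral => //.
    apply: measurableT_comp => //; apply: (measurable_int P).
    exact: integrable_dominated_section1.
  by move=> y _; rewrite /= lee_fin (le_trans (fh x y))// ler_norm.
Qed.

Lemma integrable_dominated_F : m.-integrable setT (EFin \o (fun x => \int[P]_y f (x, y))).
Proof.
rewrite (_ : EFin \o _ = fubini_F P (EFin \o f)); last exact/funext.
exact: integrable_fubini_F integrable_dominated_prod.
Qed.

Lemma measurable_dominated_G : measurable_fun setT (fun y => \int[m]_x f (x, y)).
Proof.
apply/measurable_EFinP.
rewrite (_ : EFin \o _ = fubini_G m (EFin \o f)); last exact/funext.
exact: measurable_fubini_G integrable_dominated_prod.
Qed.

Lemma Rintegral_dominated_fubini :
  \int[m]_x \int[P]_y f (x, y) = \int[P]_y \int[m]_x f (x, y).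
Proof.
rewrite /Rintegral; congr fine.
under eq_integral do rewrite EFin1.
under [RHS]eq_integral do rewrite EFin2.
exact: (Fubini integrable_dominated_prod).
Qed.

End dominated_fubini.

(** * Gaussian integrals in dimension [d] *)

(** The integral of $\exp(-c|x|^2/2)$ over $\mathbb R^d$; [gconst d 1] normalises the standard
    Gaussian density. *)
Definition gconst (R : realType) (d : nat) (c : R) : R := Num.sqrt (2 * pi / c) ^+ d.

Section euclidean.
Context {R : realType} {d : nat}.
Implicit Types x y : d.-tuple R.

Definition dotp x y : R := \sum_(i < d) tnth x i * tnth y i.

Lemma measurable_dotp {d1} (T : measurableType d1) (f g : T -> d.-tuple R) :
  measurable_fun setT f -> measurable_fun setT g ->
  measurable_fun setT (fun t => dotp (f t) (g t)).
Proof.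
move=> mf mg; apply: measurable_sum => i; apply: measurable_funM.
  exact: (measurableT_comp (measurable_tnth i) mf).
exact: (measurableT_comp (measurable_tnth i) mg).
Qed.

Lemma gauss_expR_prod (a x : d.-tuple R) (c : R) :
  expR (dotp a x - c / 2 * dotp x x) =
  \prod_(i < d) expR (tnth a i * tnth x i - c / 2 * tnth x i ^+ 2).
Proof.
rewrite -expR_sum; congr expR; rewrite big_split/= sumrN mulr_sumr.
by congr (_ - _); apply: eq_bigr => i _; rewrite expr2.
Qed.

Lemma integral_gauss (a : d.-tuple R) (c : R) : 0 < c ->
  (\int[lebesgue_tuple d]_x (expR (dotp a x - c / 2 * dotp x x))%:E =
   (gconst d c * expR (dotp a a / (2 * c)))%:E)%E.
Proof.
move=> c0; under eq_integral do rewrite gauss_expR_prod.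
rewrite (integral_lebesgue_tuple_prod
  (f := fun i (z : R) => expR (tnth a i * z - c / 2 * z ^+ 2))); last 2 first.
- move=> i; apply: measurableT_comp => //; apply: measurable_funB.
    exact: measurable_funM.
  by apply: measurable_funM => //; exact: measurable_funX.
- by move=> i y; rewrite expR_ge0.
under eq_bigr do rewrite integral_gauss_1d//.
rewrite prodEFin big_split/= prodr_const card_ord; congr (_ * _)%:E.
by rewrite -expR_sum mulr_suml.
Qed.

Lemma integrable_gauss (a : d.-tuple R) (c : R) : 0 < c ->
  (lebesgue_tuple d).-integrable setT
    (EFin \o (fun x => expR (dotp a x - c / 2 * dotp x x))).
Proof.
move=> c0; apply/integrableP; split.
  apply/measurable_EFinP; apply: measurableT_comp => //.
  by apply: measurable_funB; [|apply: measurable_funM => //]; exact: measurable_dotp.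
under eq_integral do rewrite /= ger0_norm ?expR_ge0//.
by rewrite integral_gauss// ltry.
Qed.

Lemma Rintegral_gauss (a : d.-tuple R) (c : R) : 0 < c ->
  \int[lebesgue_tuple d]_x expR (dotp a x - c / 2 * dotp x x) =
  gconst d c * expR (dotp a a / (2 * c)).
Proof. by move=> c0; rewrite /Rintegral integral_gauss. Qed.

End euclidean.

(** * Integration against the signed measure and its quadratic form *)

Section signed_functional.
Context {R : realType} {d : nat}.
Notation T := (d.-tuple R).
Variables (P Q : probability T R) (V : T -> T) (M : R).
Hypotheses (mV : measurable_fun setT V) (bV : forall u i, `|tnth (V u) i| <= M).

(* Integration against the signed measure [P - Q] pushed forward by [V]; the
   map [V], to be a retraction onto the cube, makes every integrand bounded. *)
Definition nu (f : T -> R) : R := \int[P]_u f (V u) - \int[Q]_u f (V u).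

Definition nu_adm (f : T -> R) :=
  measurable_fun setT (f \o V) /\ exists K, forall u, `|f (V u)| <= K.

Definition nu_adm2 (F : T -> T -> R) :=
  measurable_fun setT (fun z : T * T => F (V z.1) (V z.2)) /\
  exists K, forall u v, `|F (V u) (V v)| <= K.

(** The quadratic form $\iint F\,d\nu\,d\nu$, as an iterated integral. *)
Definition nunu (F : T -> T -> R) : R := nu (fun u => nu (F u)).

Lemma nu_adm_integrable (m : probability T R) f :
  nu_adm f -> m.-integrable setT (EFin \o (fun u => f (V u))).
Proof.
move=> [mf [K fK]].
apply: (le_integrable measurableT _ _ (finite_measure_integrable_cst m K measurableT)).
  exact/measurable_EFinP.
by move=> u _ /=; rewrite lee_fin (le_trans (fK u))// ler_norm.
Qed.

Lemma eq_nu f g : (forall u, f (V u) = g (V u)) -> nu f = nu g.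
Proof. by move=> fg; congr (_ - _); apply: eq_Rintegral => u _. Qed.

Lemma nuZ k f : nu_adm f -> nu (fun u => k * f u) = k * nu f.
Proof.
by move=> af; rewrite /nu !RintegralZl ?mulrBr//; exact: nu_adm_integrable.
Qed.

Lemma nuD f g : nu_adm f -> nu_adm g -> nu (fun u => f u + g u) = nu f + nu g.
Proof.
move=> af ag; rewrite /nu !RintegralD//; try exact: nu_adm_integrable.
by rewrite opprD addrACA.
Qed.

Lemma nu_admD f g : nu_adm f -> nu_adm g -> nu_adm (fun u => f u + g u).
Proof.
move=> [mf [K fK]] [mg [L gL]]; split; first exact: measurable_funD.
by exists (K + L) => u; rewrite (le_trans (ler_normD _ _))// lerD.
Qed.

Lemma nu_adm_cst k : nu_adm (fun=> k).
Proof. by split; [exact: measurable_cst | exists `|k|]. Qed.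

Lemma nu_adm_sum I (s : seq I) (f : I -> T -> R) :
  (forall i, nu_adm (f i)) -> nu_adm (fun u => \sum_(i <- s) f i u).
Proof.
move=> af; elim: s => [|i s IH].
  by under [X in nu_adm X]funext do rewrite big_nil; exact: nu_adm_cst.
by under [X in nu_adm X]funext do rewrite big_cons; exact: nu_admD.
Qed.

Lemma nu_sum I (s : seq I) (f : I -> T -> R) : (forall i, nu_adm (f i)) ->
  nu (fun u => \sum_(i <- s) f i u) = \sum_(i <- s) nu (f i).
Proof.
move=> af; elim: s => [|i s IH].
  rewrite big_nil (@eq_nu _ (fun=> 0 * 0)); last by move=> u; rewrite big_nil mul0r.
  by rewrite nuZ ?mul0r//; exact: nu_adm_cst.
rewrite big_cons -IH -nuD//; last exact: nu_adm_sum.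
by apply: eq_nu => u; rewrite big_cons.
Qed.

Lemma normr_Rintegral_prob_le (m : probability T R) f K : nu_adm f ->
  (forall u, `|f (V u)| <= K) -> `|\int[m]_u f (V u)| <= K.
Proof.
move=> af fK; have imf := nu_adm_integrable m af.
rewrite (le_trans (le_normr_Rintegral _ imf))//.
rewrite (@le_trans _ _ (\int[m]_u (K : R)))//.
  apply: le_Rintegral => //; last exact: finite_measure_integrable_cst.
  exact: integrable_norm imf.
by rewrite Rintegral_cst// [X in fine X](@probability_setT _ _ _ m) mulr1.
Qed.

Lemma nu_bound f K : nu_adm f -> (forall u, `|f (V u)| <= K) -> `|nu f| <= 2 * K.
Proof.
move=> af fK; rewrite (le_trans (ler_normB _ _))// mulr_natl mulr2n.
by rewrite lerD//; exact: normr_Rintegral_prob_le.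
Qed.

Section fubini.
Context d1 (S : measurableType d1) (m : {sigma_finite_measure set S -> \bar R}).
Variables (f : S -> T -> R) (h : S -> R).
Hypothesis mf : measurable_fun setT (fun z : S * T => f z.1 (V z.2)).
Hypothesis fh : forall x u, `|f x (V u)| <= h x.
Hypothesis ih : m.-integrable setT (EFin \o h).

Lemma integrable_nu : m.-integrable setT (EFin \o (fun x => nu (f x))).
Proof.
have iP := integrable_dominated_F P mf fh ih.
have iQ := integrable_dominated_F Q mf fh ih.
exact: (integrableB measurableT iP iQ).
Qed.

Lemma nu_fubini : \int[m]_x nu (f x) = nu (fun u => \int[m]_x f x u).
Proof.
rewrite RintegralB//.
- by congr (_ - _); exact: (Rintegral_dominated_fubini _ mf fh ih).
- exact: (integrable_dominated_F P mf fh ih).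
- exact: (integrable_dominated_F Q mf fh ih).
Qed.

End fubini.

Lemma nu_adm2_sec F u : nu_adm2 F -> nu_adm (F (V u)).
Proof.
move=> [mF [K FK]]; split; last by exists K.
exact: (measurableT_comp mF (measurable_pair1 u)).
Qed.

Lemma nu_adm2_nu F : nu_adm2 F -> nu_adm (fun u => nu (F u)).
Proof.
move=> aF; have [mF [K FK]] := aF; split; last first.
  exists (2 * K) => u; apply: nu_bound => //; exact: nu_adm2_sec.
have mswap : measurable_fun setT (fun z : T * T => F (V z.2) (V z.1)).
  exact: (measurableT_comp mF (measurable_fun_pair measurable_snd measurable_fst)).
apply: measurable_funB.
- exact: (measurable_dominated_G (m := P) P (h := fun=> K) mswap
    (fun x y => FK y x) (finite_measure_integrable_cst P K measurableT)).
- exact: (measurable_dominated_G (m := Q) Q (h := fun=> K) mswap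
    (fun x y => FK y x) (finite_measure_integrable_cst Q K measurableT)).
Qed.

Lemma eq_nunu F G : (forall u v, F (V u) (V v) = G (V u) (V v)) -> nunu F = nunu G.
Proof. by move=> FG; apply: eq_nu => u; exact: eq_nu. Qed.

Lemma nu_adm2D F G : nu_adm2 F -> nu_adm2 G -> nu_adm2 (fun u v => F u v + G u v).
Proof.
move=> [mf [K fK]] [mg [L gL]]; split; first exact: measurable_funD.
by exists (K + L) => u v; rewrite (le_trans (ler_normD _ _))// lerD.
Qed.

Lemma nu_adm2Z k F : nu_adm2 F -> nu_adm2 (fun u v => k * F u v).
Proof.
move=> [mf [K fK]]; split; first exact: measurable_funM.
by exists (`|k| * K) => u v; rewrite normrM ler_wpM2l.
Qed.

Lemma nu_adm2_cst k : nu_adm2 (fun _ _ => k).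
Proof. by split; [exact: measurable_cst | exists `|k|]. Qed.

Lemma nu_adm2_sum I (s : seq I) (F : I -> T -> T -> R) :
  (forall i, nu_adm2 (F i)) -> nu_adm2 (fun u v => \sum_(i <- s) F i u v).
Proof.
move=> aF; elim: s => [|i s IH].
  rewrite (_ : (fun u v => _) = fun _ _ => 0); first exact: nu_adm2_cst.
  by apply/funext => u; apply/funext => v; rewrite big_nil.
rewrite (_ : (fun u v => _) = fun u v => F i u v + \sum_(i <- s) F i u v).
  exact: nu_adm2D.
by apply/funext => u; apply/funext => v; rewrite big_cons.
Qed.

Lemma nunuD F G : nu_adm2 F -> nu_adm2 G ->
  nunu (fun u v => F u v + G u v) = nunu F + nunu G.
Proof.
move=> aF aG; rewrite /nunu -nuD; try exact: nu_adm2_nu.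
by apply: eq_nu => u; rewrite nuD//; exact: nu_adm2_sec.
Qed.

Lemma nunuZ k F : nu_adm2 F -> nunu (fun u v => k * F u v) = k * nunu F.
Proof.
move=> aF; rewrite /nunu -nuZ; last exact: nu_adm2_nu.
by apply: eq_nu => u; rewrite nuZ//; exact: nu_adm2_sec.
Qed.

Lemma nunu_sum I (s : seq I) (F : I -> T -> T -> R) : (forall i, nu_adm2 (F i)) ->
  nunu (fun u v => \sum_(i <- s) F i u v) = \sum_(i <- s) nunu (F i).
Proof.
move=> aF; rewrite /nunu -nu_sum; last by move=> i; exact: nu_adm2_nu.
by apply: eq_nu => u; rewrite nu_sum// => i; exact: nu_adm2_sec.
Qed.

Lemma nunu_bound F K : nu_adm2 F -> (forall u v, `|F (V u) (V v)| <= K) ->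
  `|nunu F| <= 4 * K.
Proof.
move=> aF FK; rewrite (_ : 4 * K = 2 * (2 * K)); last by ring.
apply: nu_bound => [|u]; first exact: nu_adm2_nu.
by apply: nu_bound => //; exact: nu_adm2_sec.
Qed.

(** Rank-one kernels have a square as their form; the positivity of the moment forms comes from
    here. *)
Lemma nunuM f : nu_adm f -> nunu (fun u v => f u * f v) = nu f ^+ 2.
Proof.
move=> af; rewrite /nunu expr2 -nuZ//; apply: eq_nu => u.
by rewrite nuZ// mulrC.
Qed.

Lemma normr_dotpV u v : 0 <= M -> `|dotp (V u) (V v)| <= d%:R * M ^+ 2.
Proof.
move=> M0; rewrite (le_trans (ler_norm_sum _ _ _))//.
rewrite (@le_trans _ _ (\sum_(i < d) M ^+ 2))//; last first.
  by rewrite sumr_const card_ord mulr_natl.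
by apply: ler_sum => i _; rewrite normrM expr2 ler_pM.
Qed.

Lemma measurable_tnthV i : measurable_fun setT (fun u => tnth (V u) i).
Proof. exact: (measurableT_comp (measurable_tnth i) mV). Qed.

Lemma nu_adm_mono n (s : {ffun 'I_n -> 'I_d}) :
  nu_adm (fun u => \prod_(k < n) tnth u (s k)).
Proof.
split; first by apply: measurable_prod => k _; exact: measurable_tnthV.
exists (\prod_(k < n) M) => u; rewrite normr_prod.
by apply: ler_prod => k _; rewrite normr_ge0/=.
Qed.

(** The inner product of the tensor powers $u^{\otimes n}$ and $v^{\otimes n}$, whose coordinates
    are indexed by the words [s] of length [n]. *)
Lemma dotp_expE (u v : T) n : dotp u v ^+ n =
  \sum_(s : {ffun 'I_n -> 'I_d})
    (\prod_(k < n) tnth u (s k)) * (\prod_(k < n) tnth v (s k)).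
Proof.
rewrite -[X in _ ^+ X]card_ord -prodr_const /dotp bigA_distr_bigA/=.
by apply: eq_bigr => s _; rewrite -big_split.
Qed.

Lemma measurable_dotpV : measurable_fun setT (fun z : T * T => dotp (V z.1) (V z.2)).
Proof.
apply: measurable_dotp.
  exact: (measurableT_comp mV measurable_fst).
exact: (measurableT_comp mV measurable_snd).
Qed.

(** The form equals $|m_n|^2$, with $m_n$ the $n$-th moment tensor: the expansion over words makes
    it a sum of squares. *)
Lemma nunu_dotp_exp_ge0 n : 0 <= nunu (fun u v => dotp u v ^+ n).
Proof.
rewrite (eq_nunu (G := fun u v => \sum_(s : {ffun 'I_n -> 'I_d})
    (\prod_(k < n) tnth u (s k)) * (\prod_(k < n) tnth v (s k)))); last first.
  by move=> u v; rewrite dotp_expE.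
rewrite nunu_sum => [|s]; last first.
  have [mf [K fK]] := nu_adm_mono s; split.
    apply: measurable_funM.
      exact: (measurableT_comp mf measurable_fst).
    exact: (measurableT_comp mf measurable_snd).
  by exists (K * K) => u v; rewrite normrM ler_pM.
apply: sumr_ge0 => s _.
by rewrite (nunuM (nu_adm_mono s)) sqr_ge0.
Qed.

End signed_functional.

(** * Shifted Gaussian integrals, Young's inequality and Cauchy-Schwarz *)

Lemma measurable_expR_comp d (T : measurableType d) (R : realType) (f : T -> R) :
  measurable_fun setT f -> measurable_fun setT (fun x => expR (f x)).
Proof. by move=> mf; exact: measurableT_comp. Qed.

Section gaussian_shift.
Context {R : realType} {d : nat}.
Implicit Types u v x : d.-tuple R.

Definition lin_tuple (a b : R) u v : d.-tuple R :=
  [tuple a * tnth u i + b * tnth v i | i < d].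

Lemma dotpC u v : dotp u v = dotp v u.
Proof. by apply: eq_bigr => i _; rewrite mulrC. Qed.

Lemma dotp_linl (a b : R) u v x :
  dotp (lin_tuple a b u v) x = a * dotp u x + b * dotp v x.
Proof.
rewrite !mulr_sumr -big_split/=; apply: eq_bigr => i _.
by rewrite tnth_mktuple; ring.
Qed.

Lemma dotp_ge0 u : 0 <= dotp u u.
Proof. by apply: sumr_ge0 => i _; rewrite -expr2 sqr_ge0. Qed.

(** Young's inequality, by completing the square in each coordinate; it trades a linear exponent for
    an arbitrarily small quadratic one. *)
Lemma dotp_young (b e : R) u v : 0 < e ->
  b * dotp u v <= e * dotp u u + b ^+ 2 / (4 * e) * dotp v v.
Proof.
move=> e0; rewrite !mulr_sumr -big_split/=; apply: ler_sum => i _.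
set x := tnth u i; set y := tnth v i.
rewrite -subr_ge0.
have -> : e * (x * x) + b ^+ 2 / (4 * e) * (y * y) - b * (x * y) =
    e * (x - b / (2 * e) * y) ^+ 2 by field; rewrite gt_eqF.
by rewrite mulr_ge0 ?sqr_ge0// ltW.
Qed.

Let shiftE (a b e c : R) u v x :
  expR (a * dotp u x + b * dotp v x - c / 2 * dotp x x + e) =
  expR e * expR (dotp (lin_tuple a b u v) x - c / 2 * dotp x x).
Proof. by rewrite -expRD dotp_linl addrC. Qed.

Lemma integrable_gauss_shift (a b e c : R) u v : 0 < c ->
  (lebesgue_tuple d).-integrable setT
    (EFin \o (fun x => expR (a * dotp u x + b * dotp v x - c / 2 * dotp x x + e))).
Proof.
move=> c0; under [X in _.-integrable _ (_ \o X)]funext do rewrite shiftE.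
exact: (integrableZl measurableT (expR e) (integrable_gauss (lin_tuple a b u v) c0)).
Qed.

Lemma Rintegral_gauss_shift (a b e c : R) u v : 0 < c ->
  \int[lebesgue_tuple d]_x
     expR (a * dotp u x + b * dotp v x - c / 2 * dotp x x + e) =
  gconst d c * expR ((a ^+ 2 * dotp u u + 2 * a * b * dotp u v + b ^+ 2 * dotp v v)
                   / (2 * c) + e).
Proof.
move=> c0; under eq_Rintegral do rewrite shiftE.
rewrite RintegralZl//; last exact: integrable_gauss.
rewrite Rintegral_gauss// mulrCA -expRD; congr (_ * expR _).
rewrite dotp_linl [dotp u _]dotpC [dotp v (lin_tuple _ _ _ _)]dotpC !dotp_linl.
by rewrite [dotp v u]dotpC; field; rewrite gt_eqF.
Qed.

Lemma gconst_gt0 (c : R) : 0 < c -> 0 < gconst d c.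
Proof.
by move=> c0; rewrite exprn_gt0// sqrtr_gt0 divr_gt0// mulr_gt0// pi_gt0.
Qed.

Lemma integrable_gauss0 (c C : R) : 0 < c ->
  (lebesgue_tuple d).-integrable setT
    (EFin \o (fun x => C * expR (- c * dotp x x))).
Proof.
move=> c0; suff h : (lebesgue_tuple d).-integrable setT
    (EFin \o (fun x : d.-tuple R => expR (- c * dotp x x))).
  exact: (integrableZl measurableT C h).
have c20 : 0 < 2 * c by rewrite mulr_gt0.
have := integrable_gauss_shift 0 0 0 [tuple 0 | i < d] [tuple 0 | i < d] c20.
apply: eq_integrable => // x _ /=; congr (expR _)%:E.
by field.
Qed.

Lemma Rintegral_gauss0 (c C : R) : 0 < c ->
  \int[lebesgue_tuple d]_x (C * expR (- c * dotp x x)) = C * gconst d (2 * c).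
Proof.
move=> c0.
have i1 := integrable_gauss0 1 c0.
transitivity (\int[lebesgue_tuple d]_x (C * (1 * expR (- c * dotp x x)))).
  by apply: eq_Rintegral => x _; rewrite mul1r.
rewrite RintegralZl//; congr (_ * _).
have c20 : 0 < 2 * c by rewrite mulr_gt0.
have := Rintegral_gauss_shift 0 0 0 [tuple 0 | i < d] [tuple 0 | i < d] c20.
rewrite expr0n/= !(mul0r, mulr0, addr0) expR0 mulr1 => <-.
by apply: eq_Rintegral => x _; rewrite mul1r; congr expR; field.
Qed.

End gaussian_shift.

(* Cauchy-Schwarz, through the discriminant of
   [l |-> \int (f - l g)^2]. *)
Lemma Rintegral_cauchy_schwarz d1 (S : measurableType d1) (R : realType)
    (m : {measure set S -> \bar R}) (f g w : S -> R) :
  (forall x, 0 <= w x) ->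
  m.-integrable setT (EFin \o (fun x => f x ^+ 2 * w x)) ->
  m.-integrable setT (EFin \o (fun x => f x * g x * w x)) ->
  m.-integrable setT (EFin \o (fun x => g x ^+ 2 * w x)) ->
  (\int[m]_x (f x * g x * w x)) ^+ 2 <=
  \int[m]_x (f x ^+ 2 * w x) * \int[m]_x (g x ^+ 2 * w x).
Proof.
move=> w0 iff ifg igg.
set A := \int[m]_x (f x ^+ 2 * w x); set B := \int[m]_x (f x * g x * w x).
set C := \int[m]_x (g x ^+ 2 * w x).
have key l : 0 <= A + (- (2 * l)) * B + l ^+ 2 * C.
  have : 0 <= \int[m]_x ((f x - l * g x) ^+ 2 * w x).
    by apply: Rintegral_ge0 => x _; rewrite mulr_ge0// sqr_ge0.
  under eq_Rintegral.
    move=> x _; rewrite (_ : _ * _ = f x ^+ 2 * w x + (- (2 * l)) * (f x * g x * w x)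
       + l ^+ 2 * (g x ^+ 2 * w x)); last by ring.
    over.
  have i1 := integrableZl measurableT (- (2 * l)) ifg.
  have i2 := integrableZl measurableT (l ^+ 2) igg.
  have i3 := integrableD measurableT iff i1.
  by rewrite RintegralD// RintegralD// !RintegralZl.
have C0 : 0 <= C by apply: Rintegral_ge0 => x _; rewrite mulr_ge0// sqr_ge0.
have [C00|Cn0] := eqVneq C 0.
  rewrite C00 mulr0 real_exprn_even_le0 ?num_real//=.
  have [//|Bn0] := eqVneq B 0.
  (* For [C = 0] the quadratic in [l] is affine; were [B] nonzero, this [l] would give it the value
     [-1]. *)
  have := key ((A + 1) / (2 * B)).
  rewrite C00 mulr0 addr0 (_ : - _ * B = - (A + 1)); last by field.
  by lra.
have Cp : 0 < C by rewrite lt_neqAle eq_sym Cn0.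
(* The minimiser of the quadratic. *)
have := key (B / C).
rewrite (_ : _ + _ = A - B ^+ 2 / C); last by field.
by rewrite subr_ge0 ler_pdivrMr.
Qed.

(** * The transform with Hermite generating kernel, and its energy *)

Section gaussian_transform.
Context {R : realType} {d : nat}.
Notation T := (d.-tuple R).
Variables (P Q : probability T R) (V : T -> T) (M : R).
Hypotheses (mV : measurable_fun setT V) (bV : forall u i, `|tnth (V u) i| <= M).
Hypothesis M0 : 0 <= M.
Let mu := @lebesgue_tuple R d.
Let nu := nu P Q V.
Let K := d%:R * M ^+ 2.

(* [gkernel b x u] is the generating function [\sum_n b^n He_n(x) u^n / n!] of the
   Hermite polynomials. With [m_n] the moment tensors of [nu], [gtrans b] thus has
   Hermite coefficients [b^n m_n] and [genergy s = \sum_n s^n |m_n|^2 / n!]. *)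
Definition gkernel (b : R) (x u : T) : R := expR (b * dotp x u - b ^+ 2 / 2 * dotp u u).
Definition gweight (x : T) : R := expR (- 2^-1 * dotp x x).
Definition gtrans (b : R) (x : T) : R := nu (gkernel b x).
Definition genergy (s : R) : R := nunu P Q V (fun u v => expR (s * dotp u v)).

Let dotpVV u : dotp (V u) (V u) <= K.
Proof. exact: (le_trans (ler_norm _) (normr_dotpV bV _ _ M0)). Qed.

Let K0 : 0 <= K. Proof. by rewrite mulr_ge0 ?sqr_ge0. Qed.

(** Young's inequality handles the linear term and the negative term is dropped. A small [e] lets a
    Gaussian weight absorb the growth in [x]. *)
Lemma gkernel_bound (b e : R) x u : 0 < e ->
  gkernel b x (V u) <= expR (b ^+ 2 / (4 * e) * K) * expR (e * dotp x x).
Proof.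
move=> e0; rewrite -expRD ler_expR.
have := dotp_young b x (V u) e0.
have : b ^+ 2 / (4 * e) * dotp (V u) (V u) <= b ^+ 2 / (4 * e) * K.
  by rewrite ler_wpM2l// divr_ge0 ?sqr_ge0// mulr_ge0// ltW.
have : 0 <= b ^+ 2 / 2 * dotp (V u) (V u).
  by rewrite mulr_ge0 ?dotp_ge0// divr_ge0 ?sqr_ge0.
by lra.
Qed.

Lemma gkernel_ge0 b x u : 0 <= gkernel b x u. Proof. exact: expR_ge0. Qed.

Lemma measurable_gkernel b :
  measurable_fun setT (fun z : T * T => gkernel b z.1 (V z.2)).
Proof.
apply: measurable_expR_comp; apply: measurable_funB.
  apply: measurable_funM => //; apply: measurable_dotp; first exact: measurable_fst.
  exact: (measurableT_comp mV measurable_snd).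
apply: measurable_funM => //.
by apply: measurable_dotp; exact: (measurableT_comp mV measurable_snd).
Qed.

Lemma nu_adm_gkernel b x : nu_adm V (gkernel b x).
Proof.
split; first exact: (measurableT_comp (measurable_gkernel b) (measurable_pair1 x)).
exists (expR (b ^+ 2 / (4 * 1) * K) * expR (1 * dotp x x)) => u.
by rewrite ger0_norm ?gkernel_ge0//; exact: gkernel_bound.
Qed.

Lemma gtrans_bound b (e : R) x : 0 < e ->
  `|gtrans b x| <= 2 * expR (b ^+ 2 / (4 * e) * K) * expR (e * dotp x x).
Proof.
move=> e0; rewrite -mulrA; apply: nu_bound; first exact: nu_adm_gkernel.
by move=> u; rewrite ger0_norm ?gkernel_ge0//; exact: gkernel_bound.
Qed.

Lemma nu_adm2_expR s : nu_adm2 V (fun u v => expR (s * dotp u v)).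
Proof.
split.
  apply: measurable_expR_comp; apply: measurable_funM => //; exact: measurable_dotpV.
exists (expR (`|s| * K)) => u v; rewrite ger0_norm ?expR_ge0// ler_expR.
by rewrite (le_trans (ler_norm _))// normrM ler_wpM2l//; exact: normr_dotpV.
Qed.

Section against.
Variables (b C : R) (H : T -> R).
Hypothesis mH : measurable_fun setT H.
Hypothesis bH : forall x, `|H x| <= C * expR (- 4^-1 * dotp x x).

(** Taking [e = 8^-1] in [gkernel_bound] uses up half of the decay of [H]; the other half makes the
    dominating function [h] integrable. *)
Let kb := expR (b ^+ 2 / (4 * 8^-1) * K).
Let h (x : T) := (C * kb) * expR (- 8^-1 * dotp x x).

Let mf : measurable_fun setT (fun z : T * T => gkernel b z.1 (V z.2) * H z.1).
Proof.
apply: measurable_funM; first exact: measurable_gkernel.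
exact: (measurableT_comp mH measurable_fst).
Qed.

Let fh x u : `|gkernel b x (V u) * H x| <= h x.
Proof.
rewrite normrM ger0_norm ?gkernel_ge0// /h.
rewrite (_ : - 8^-1 * dotp x x = 8^-1 * dotp x x + - 4^-1 * dotp x x); last by field.
rewrite expRD (_ : C * kb * _ = (kb * expR (8^-1 * dotp x x)) *
  (C * expR (- 4^-1 * dotp x x))); last by ring.
apply: ler_pM => //; first exact: gkernel_ge0.
by apply: gkernel_bound; rewrite invr_gt0.
Qed.

Let ih : mu.-integrable setT (EFin \o h).
Proof. exact: integrable_gauss0. Qed.

Let nuE x : nu (fun u => gkernel b x u * H x) = gtrans b x * H x.
Proof.
rewrite [RHS]mulrC -nuZ; last exact: nu_adm_gkernel.
by apply: eq_nu => u; rewrite mulrC.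
Qed.

Lemma integrable_gtrans_against :
  mu.-integrable setT (EFin \o (fun x => gtrans b x * H x)).
Proof.
have := integrable_nu P Q (f := fun x u => gkernel b x u * H x) mf fh ih.
by apply: eq_integrable => // x _; rewrite /= -nuE.
Qed.

Lemma gtrans_against_fubini :
  \int[mu]_x (gtrans b x * H x) = nu (fun u => \int[mu]_x (gkernel b x u * H x)).
Proof.
transitivity (\int[mu]_x nu (fun u => gkernel b x u * H x)).
  by apply: eq_Rintegral => x _; rewrite nuE.
exact: (nu_fubini P Q (f := fun x u => gkernel b x u * H x) mf fh ih).
Qed.

End against.

Lemma measurable_gweight : measurable_fun setT gweight.
Proof.
apply: measurable_expR_comp; apply: measurable_funM => //.
by apply: measurable_dotp; exact: measurable_id.
Qed.

(** Integrability against a positive Gaussian [H] includes measurability of the product; dividing by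
    [H] gives the claim. *)
Lemma measurable_gtrans b : measurable_fun setT (gtrans b).
Proof.
pose H (x : T) := expR (- 4^-1 * dotp x x).
have mH : measurable_fun setT H.
  apply: measurable_expR_comp; apply: measurable_funM => //.
  by apply: measurable_dotp; exact: measurable_id.
have bH x : `|H x| <= 1 * expR (- 4^-1 * dotp x x).
  by rewrite mul1r ger0_norm ?expR_ge0.
have /measurable_int/measurable_EFinP mGH := integrable_gtrans_against b mH bH.
rewrite (_ : gtrans b = (fun x => gtrans b x * H x * (H x)^-1)).
  apply: measurable_funM => //.
  rewrite (_ : (fun x => _) = fun x => expR (- (- 4^-1 * dotp x x))).
    apply: measurable_expR_comp; apply: measurableT_comp => //.
    apply: measurable_funM => //.
    by apply: measurable_dotp; exact: measurable_id.
  by apply/funext => x; rewrite expRN.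
by apply/funext => x; rewrite mulfK// gt_eqF// expR_gt0.
Qed.

Lemma gtrans_weight_bound b x :
  `|gtrans b x * gweight x| <=
  (2 * expR (b ^+ 2 / (4 * 4^-1) * K)) * expR (- 4^-1 * dotp x x).
Proof.
have e0 : (0 : R) < 4^-1 by rewrite invr_gt0.
rewrite normrM [`|gweight x|]ger0_norm ?expR_ge0//.
rewrite (_ : - 4^-1 * dotp x x = 4^-1 * dotp x x + - 2^-1 * dotp x x); last by field.
by rewrite expRD mulrA ler_wpM2r ?expR_ge0//; exact: gtrans_bound.
Qed.

Lemma measurable_gtrans_weight b : measurable_fun setT (fun x => gtrans b x * gweight x).
Proof. by apply: measurable_funM; [exact: measurable_gtrans|exact: measurable_gweight]. Qed.

Lemma integrable_gtransM a b :
  mu.-integrable setT (EFin \o (fun x => gtrans a x * (gtrans b x * gweight x))).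
Proof.
exact: (integrable_gtrans_against a (measurable_gtrans_weight b) (gtrans_weight_bound b)).
Qed.

(** Parseval's identity for the Hermite expansion: after Fubini in both factors, a Gaussian integral
    of two kernels leaves [expR (a * b * dotp u v)]. *)
Lemma Rintegral_gtransM a b :
  \int[mu]_x (gtrans a x * (gtrans b x * gweight x)) = gconst d 1 * genergy (a * b).
Proof.
rewrite (gtrans_against_fubini a (measurable_gtrans_weight b) (gtrans_weight_bound b)).
rewrite /genergy -nunuZ; last exact: nu_adm2_expR.
apply: eq_nu => u.
have mH : measurable_fun setT (fun x => gkernel a x (V u) * gweight x).
  apply: measurable_funM; last exact: measurable_gweight.
  apply: measurable_expR_comp; apply: measurable_funB => //.
  by apply: measurable_funM => //; apply: measurable_dotp => //; exact: measurable_id.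
have bH x : `|gkernel a x (V u) * gweight x| <=
    expR (a ^+ 2 / (4 * 4^-1) * K) * expR (- 4^-1 * dotp x x).
  have e0 : (0 : R) < 4^-1 by rewrite invr_gt0.
  rewrite ger0_norm ?mulr_ge0 ?expR_ge0//.
  rewrite (_ : - 4^-1 * dotp x x = 4^-1 * dotp x x + - 2^-1 * dotp x x); last by field.
  by rewrite expRD mulrA ler_wpM2r ?expR_ge0//; exact: gkernel_bound.
transitivity (\int[mu]_x (gtrans b x * (gkernel a x (V u) * gweight x))).
  by apply: eq_Rintegral => x _; ring.
rewrite (gtrans_against_fubini b mH bH); apply: eq_nu => v.
transitivity (\int[mu]_x expR (b * dotp (V v) x + a * dotp (V u) x - 1 / 2 * dotp x x +
   (- (b ^+ 2 / 2 * dotp (V v) (V v)) - a ^+ 2 / 2 * dotp (V u) (V u)))).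
  apply: eq_Rintegral => x _; rewrite -!expRD; congr expR.
  by rewrite [dotp x (V v)]dotpC [dotp x (V u)]dotpC; field.
rewrite Rintegral_gauss_shift//; congr (_ * expR _).
by rewrite [dotp (V v) (V u)]dotpC; field.
Qed.

(* The Mehler kernel of the Ornstein-Uhlenbeck semigroup maps [gtrans b] to
   [gtrans (a * b)]; Cauchy-Schwarz then yields a pointwise bound whose growth
   [exp (r / (1 + r) |x|^2)] is sharp, and is at most [exp (|x|^2 / 2)]. *)
Lemma gtrans_sqr_le (a b r : R) x : a ^+ 2 = r -> 0 < r -> r < 1 ->
  gtrans (a * b) x ^+ 2 <=
  gconst d 1 * gconst d ((1 + r) / (1 - r)) / gconst d (1 / (1 - r)) ^+ 2 *
    genergy (b ^+ 2) * expR (r / (1 + r) * dotp x x).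
Proof.
move=> ar r0 r1.
have s0 : 0 < 1 - r by rewrite subr_gt0.
have sn0 : 1 - r != 0 by rewrite gt_eqF.
(* The Mehler kernel relative to [gweight], up to a factor independent of [y]. *)
pose k (y : T) := expR (a / (1 - r) * dotp x y - r / (2 * (1 - r)) * dotp y y).
have mdot : measurable_fun setT (fun y : T => dotp y y).
  by apply: measurable_dotp; exact: measurable_id.
have mk : measurable_fun setT k.
  apply: measurable_expR_comp; apply: measurable_funB.
    by apply: measurable_funM => //; apply: measurable_dotp => //; exact: measurable_id.
  exact: measurable_funM.
have mkw : measurable_fun setT (fun y => k y * gweight y).
  by apply: measurable_funM => //; exact: measurable_gweight.
have bkw y : `|k y * gweight y| <=
    expR ((a / (1 - r)) ^+ 2 / (4 * 4^-1) * dotp x x) * expR (- 4^-1 * dotp y y).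
  have e0 : (0 : R) < 4^-1 by rewrite invr_gt0.
  rewrite ger0_norm ?mulr_ge0 ?expR_ge0// -!expRD ler_expR.
  have := dotp_young (a / (1 - r)) y x e0; rewrite [dotp y x]dotpC.
  have : 0 <= r / (2 * (1 - r)) * dotp y y.
    by rewrite mulr_ge0 ?dotp_ge0// divr_ge0 ?mulr_ge0// ltW.
  by lra.
have ifg := integrable_gtrans_against b mkw bkw.
have Bval := gtrans_against_fubini b mkw bkw.
(* Integration against [k] sends [gkernel b] to a multiple of [gkernel (a * b)], and Fubini carries
   this over to [gtrans]. *)
have Bval' : \int[mu]_y (gtrans b y * (k y * gweight y)) =
    gconst d (1 / (1 - r)) * expR (r / (2 * (1 - r)) * dotp x x) * gtrans (a * b) x.
  rewrite Bval -nuZ; last exact: nu_adm_gkernel.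
  apply: eq_nu => u.
  have c0 : 0 < 1 / (1 - r) by rewrite divr_gt0.
  transitivity (\int[mu]_y expR (b * dotp (V u) y + a / (1 - r) * dotp x y
     - 1 / (1 - r) / 2 * dotp y y + - (b ^+ 2 / 2 * dotp (V u) (V u)))).
    apply: eq_Rintegral => y _; rewrite -!expRD; congr expR.
    by rewrite [dotp y (V u)]dotpC; field.
  rewrite Rintegral_gauss_shift// -[in RHS]mulrA -expRD; congr (_ * expR _).
  rewrite [dotp (V u) x]dotpC -ar; field; rewrite ar sn0/=.
  by [].
have igg : mu.-integrable setT (EFin \o (fun y => k y ^+ 2 * gweight y)).
  have c0 : 0 < (1 + r) / (1 - r) by rewrite divr_gt0// addr_gt0.
  have := integrable_gauss_shift (2 * (a / (1 - r))) 0 0 x x c0.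
  apply: eq_integrable => // y _ /=; congr EFin.
  by rewrite expr2 -!expRD; congr expR; field.
have Cval : \int[mu]_y (k y ^+ 2 * gweight y) =
    gconst d ((1 + r) / (1 - r)) * expR (2 * r / ((1 - r) * (1 + r)) * dotp x x).
  have c0 : 0 < (1 + r) / (1 - r) by rewrite divr_gt0// addr_gt0.
  transitivity (\int[mu]_y expR (2 * (a / (1 - r)) * dotp x y + 0 * dotp x y
     - (1 + r) / (1 - r) / 2 * dotp y y + 0)).
    by apply: eq_Rintegral => y _; rewrite expr2 -!expRD; congr expR; field.
  rewrite Rintegral_gauss_shift//; congr (_ * expR _).
  rewrite -ar; field; rewrite ar sn0/= gt_eqF// addr_gt0//.
have iff : mu.-integrable setT (EFin \o (fun y => gtrans b y ^+ 2 * gweight y)).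
  have := integrable_gtransM b b.
  by apply: eq_integrable => // y _ /=; rewrite expr2 mulrA.
have Aval : \int[mu]_y (gtrans b y ^+ 2 * gweight y) = gconst d 1 * genergy (b ^+ 2).
  by rewrite [in RHS]expr2 -Rintegral_gtransM; apply: eq_Rintegral => y _; rewrite expr2 mulrA.
have ifg' : mu.-integrable setT (EFin \o (fun y => gtrans b y * k y * gweight y)).
  by apply: eq_integrable ifg => // y _ /=; rewrite mulrA.
have := @Rintegral_cauchy_schwarz _ _ _ mu (gtrans b) k gweight
  (fun y => expR_ge0 _) iff ifg' igg.
rewrite (_ : \int[mu]_x0 (gtrans b x0 * k x0 * gweight x0) =
  \int[mu]_y (gtrans b y * (k y * gweight y))); last first.
  by apply: eq_Rintegral => y _; rewrite mulrA.
rewrite Aval Cval Bval' !exprMn.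
set c := gconst d (1 / (1 - r)).
have c0 : 0 < c by rewrite gconst_gt0// divr_gt0.
set E := expR (r / _ * _).
have E2 : E ^+ 2 = expR (r / (1 - r) * dotp x x).
  by rewrite expr2 -expRD; congr expR; field.
have E0 : 0 < E ^+ 2 by rewrite exprn_gt0// expR_gt0.
(* As $2r/((1-r)(1+r)) = r/(1-r) + r/(1+r)$, the first summand cancels with the [E ^+ 2] from
   [Bval']; the second is the claimed growth rate. *)
have -> : expR (2 * r / ((1 - r) * (1 + r)) * dotp x x) =
   E ^+ 2 * expR (r / (1 + r) * dotp x x).
  rewrite E2 -expRD; congr expR; field; rewrite sn0/= gt_eqF// addr_gt0//.
move=> ineq.
have cE0 : 0 < c ^+ 2 * E ^+ 2 by rewrite mulr_gt0// exprn_gt0.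
rewrite -(ler_pM2l cE0); apply: (le_trans ineq).
rewrite le_eqVlt; apply/orP; left; apply/eqP.
by field; rewrite gt_eqF.
Qed.

End gaussian_transform.

(** * Taylor remainders and comparison of the energies at [r^-1] and [r] *)

Lemma fact_mul_le (n j : nat) : (n`! * j`! <= (n + j)`!)%N.
Proof.
have := bin_fact (leq_addr j n); rewrite addKn => <-.
by rewrite leq_pmull// bin_gt0 leq_addr.
Qed.

Lemma expR_series_ge (R : realType) (x : R) n : 0 <= x ->
  series (exp_coeff x) n <= expR x.
Proof.
move=> x0; apply: nondecreasing_cvgn_le; last exact: is_cvg_series_exp_coeff.
apply: nondecreasing_series => k _ _; exact: exp_coeff_ge0.
Qed.

(** Since $n!\,j! \le (n+j)!$, the tail is bounded termwise by $K^n/n!$ times the series of $e^K$;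
    the bound on partial sums passes to the limit. *)
Lemma expR_taylor (R : realType) (z K : R) n : `|z| <= K ->
  `|expR z - \sum_(k < n) z ^+ k / k`!%:R| <= K ^+ n / n`!%:R * expR K.
Proof.
move=> zK; have K0 : 0 <= K := le_trans (normr_ge0 _) zK.
have -> : \sum_(k < n) z ^+ k / k`!%:R = series (exp_coeff z) n.
  by rewrite /series/= big_mkord.
have cv : (fun m => `|series (exp_coeff z) m - series (exp_coeff z) n|) @ \oo -->
    `|expR z - series (exp_coeff z) n|.
  apply: cvg_norm; apply: cvgB; last exact: cvg_cst.
  exact: is_cvg_series_exp_coeff.
rewrite -(cvg_lim _ cv)//; apply: limr_le; first by apply/cvg_ex; eexists; exact: cv.
near=> m; have nm : (n <= m)%N by near: m; exact: nbhs_infty_ge.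
rewrite sub_series_geq// -[X in \sum_(X <= _ < _) _]ssrnat.add0n big_addn.
rewrite (le_trans (ler_norm_sum _ _ _))//.
rewrite (@le_trans _ _ (K ^+ n / n`!%:R * series (exp_coeff K) (m - n)%N))//; last first.
  by rewrite ler_wpM2l ?expR_series_ge// divr_ge0 ?exprn_ge0.
rewrite /series/= mulr_sumr; apply: ler_sum => j _.
rewrite /exp_coeff/= normrM normrX [`|_^-1|]ger0_norm ?invr_ge0//.
rewrite (@le_trans _ _ (K ^+ (j + n) / (j + n)`!%:R))//.
  by rewrite ler_wpM2r ?invr_ge0// lerXn2r ?nnegrE.
rewrite mulrACA -exprD addnC ler_wpM2l ?exprn_ge0// -invfM lef_pV2 ?posrE ?mulr_gt0 ?ltr0n ?fact_gt0//.
by rewrite -natrM ler_nat fact_mul_le.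
Unshelve. all: by end_near.
Qed.

Lemma ler_drop_nonpos (R : realType) (a b q t : R) :
  q <= 0 -> a - b - q <= 4 * (2 * t) -> a <= b + 8 * t.
Proof. by lra. Qed.

Section energy_comparison.
Context {R : realType} {d : nat}.
Notation T := (d.-tuple R).
Variables (P Q : probability T R) (V : T -> T) (M : R).
Hypotheses (mV : measurable_fun setT V) (bV : forall u i, `|tnth (V u) i| <= M).
Hypothesis M0 : 0 <= M.
Let K := d%:R * M ^+ 2.

Lemma nu_adm2_dotp_exp n : nu_adm2 V (fun u v => dotp u v ^+ n).
Proof.
split; first by apply: measurable_funX; exact: measurable_dotpV.
by exists (K ^+ n) => u v; rewrite normrX lerXn2r ?nnegrE ?mulr_ge0 ?sqr_ge0//;
  exact: normr_dotpV.
Qed.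

(* In degree [n <= N] the Taylor coefficient of [exp (z / r)] is dominated by
   that of [r^(-2N) exp (r z)], and the moment forms [nunu (dotp ^+ n)] are
   nonnegative; only the degrees above [N] leave a remainder. *)
Lemma genergy_le (r : R) N : 0 < r -> r < 1 ->
  genergy P Q V r^-1 <= (r^-1) ^+ N.*2 * genergy P Q V r +
    8 * ((K / r) ^+ N.+1 / N.+1`!%:R * expR (K / r)).
Proof.
move=> r0 r1.
have K0 : 0 <= K by rewrite mulr_ge0 ?sqr_ge0.
have ri1 : 1 <= r^-1 by rewrite invf_ge1// ltW.
have ri0 : 0 <= r^-1 by rewrite invr_ge0 ltW.
set tau := _ / _ * expR _.
pose c n := (r^-1) ^+ n / n`!%:R - (r^-1) ^+ N.*2 * (r ^+ n / n`!%:R).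
pose F (u v : T) := expR (r^-1 * dotp u v) + (- (r^-1) ^+ N.*2) * expR (r * dotp u v).
pose p (u v : T) := \sum_(n < N.+1) c n * dotp u v ^+ n.
have aE s := nu_adm2_expR mV bV M0 s.
have aF : nu_adm2 V F by apply: nu_adm2D => //; exact: nu_adm2Z.
have ap : nu_adm2 V p.
  by apply: nu_adm2_sum => n; apply: nu_adm2Z; exact: nu_adm2_dotp_exp.
have nF : nunu P Q V F = genergy P Q V r^-1 - (r^-1) ^+ N.*2 * genergy P Q V r.
  by rewrite nunuD ?nunuZ ?mulNr//; exact: nu_adm2Z.
have arem : nu_adm2 V (fun u v => F u v + (-1) * p u v).
  by apply: nu_adm2D => //; exact: nu_adm2Z.
have nrem : nunu P Q V (fun u v => F u v + (-1) * p u v) =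
    nunu P Q V F - nunu P Q V p.
  by rewrite nunuD ?nunuZ ?mulN1r//; exact: nu_adm2Z.
have np : nunu P Q V p <= 0.
  rewrite /p nunu_sum => [|n]; last by apply: nu_adm2Z; exact: nu_adm2_dotp_exp.
  apply: sumr_le0 => n _; rewrite nunuZ; last exact: nu_adm2_dotp_exp.
  rewrite mulr_le0_ge0//; last exact: (nunu_dotp_exp_ge0 P Q mV bV).
  rewrite /c mulrA -mulrBl mulr_le0_ge0 ?invr_ge0// subr_le0.
  have nN : (n <= N)%N by rewrite -ltnS.
  have -> : (r^-1) ^+ N.*2 = (r^-1) ^+ n * (r^-1) ^+ n * (r^-1) ^+ (N.*2 - n.*2).
    by rewrite -!exprD; congr (_ ^+ _); rewrite addnn subnKC// leq_double.
  rewrite -mulrA [_ * r ^+ n]mulrC mulrA -[_ * _ * r ^+ n]mulrA -exprMn mulVf ?gt_eqF//.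
  by rewrite expr1n mulr1 ler_peMr ?exprn_ge0// exprn_ege1.
have brem u v : `|F (V u) (V v) + (-1) * p (V u) (V v)| <= 2 * tau.
  set z := dotp (V u) (V v).
  have zK : `|z| <= K by exact: normr_dotpV.
  have z1 : `|r^-1 * z| <= K / r by rewrite normrM ger0_norm// mulrC ler_wpM2r.
  have z2 : `|r * z| <= r * K by rewrite normrM gtr0_norm// ler_wpM2l// ltW.
  have t1 := expR_taylor N.+1 z1; have t2 := expR_taylor N.+1 z2.
  have -> : F (V u) (V v) + (-1) * p (V u) (V v) =
    (expR (r^-1 * z) - \sum_(k < N.+1) (r^-1 * z) ^+ k / k`!%:R) -
    (r^-1) ^+ N.*2 * (expR (r * z) - \sum_(k < N.+1) (r * z) ^+ k / k`!%:R).
    rewrite /F /p -/z.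
    have -> : \sum_(n < N.+1) c n * z ^+ n =
      \sum_(k < N.+1) (r^-1 * z) ^+ k / k`!%:R -
       (r^-1) ^+ N.*2 * \sum_(k < N.+1) (r * z) ^+ k / k`!%:R.
      rewrite [X in _ - X]mulr_sumr -[RHS]sumrB. apply: eq_bigr => n _.
      by rewrite /c !exprMn; ring.
    by ring.
  (* Each Taylor remainder is at most [tau]; for the second, $r^{-2N} r^{N+1} \le r^{-(N+1)}$
     because $r < 1$. *)
  rewrite (le_trans (ler_normB _ _))// mulr_natl mulr2n lerD//.
  rewrite normrM ger0_norm ?exprn_ge0//.
  rewrite (le_trans (ler_wpM2l _ t2)) ?exprn_ge0// /tau mulrA.
  apply: ler_pM => //.
  - by rewrite mulr_ge0 ?exprn_ge0// divr_ge0 ?exprn_ge0// mulr_ge0// ltW.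
  - rewrite mulrA ler_wpM2r ?invr_ge0// [(r * K) ^+ _]exprMn [(K / r) ^+ _]exprMn.
    rewrite [K ^+ _ * _]mulrC mulrA ler_wpM2r ?exprn_ge0//.
    rewrite exprSr mulrA (_ : N.*2 = (N + N)%N); last by rewrite addnn.
    rewrite exprD -[_ * r ^+ N]mulrA -exprMn mulVf ?gt_eqF// expr1n mulr1.
    rewrite exprSr ler_wpM2l ?exprn_ge0//.
    exact: (le_trans (ltW r1)).
  - by rewrite ler_expR mulrC ler_wpM2l// (le_trans (ltW r1)).
have := nunu_bound P Q arem brem; rewrite nrem nF ler_norml => /andP[_].
exact: ler_drop_nonpos np.
Qed.

(** Parseval's identity with equal indices makes a positive multiple of the energy the integral of a
    square. *)
Lemma genergy_sqr_ge0 b : 0 <= genergy P Q V (b ^+ 2).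
Proof.
have := Rintegral_gtransM P Q mV bV M0 b b; rewrite -expr2 => e.
have : 0 <= gconst d 1 * genergy P Q V (b ^+ 2).
  rewrite -e; apply: Rintegral_ge0 => x _.
  by rewrite mulrA -expr2 mulr_ge0 ?sqr_ge0 ?expR_ge0.
by rewrite pmulr_rge0// gconst_gt0.
Qed.

End energy_comparison.

(** * The cutoff at a radius, and the constants of the estimates *)

(** Equal to $1/2 - r/(1+r)$: the decay left when the growth $\exp(\frac{r}{1+r}|x|^2)$ meets the
    Gaussian weight. *)
Definition mehler_rate (R : realType) (r : R) : R := (1 - r) / (2 * (1 + r)).

(* Inside the ball [n <= rho] (with [n = |x|^2]) the factor [gr] is bounded
   pointwise; outside of it both factors are, and their product decays like
   [exp (- mehler_rate r * n)]. *)
Lemma cutoff_pointwise (R : realType) (r e rho n g c s S gr g1 : R) :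
  0 < r -> r < 1 -> 0 < e -> e < 1 -> 0 <= n -> 0 < g ->
  0 <= c -> 0 <= s -> 0 <= S ->
  `|gr| <= c * s * expR (r / (2 * (1 + r)) * n) ->
  `|g1| <= c * S * expR (r / (2 * (1 + r)) * n) ->
  `|gr * (g^-1 * (g1 * expR (- 2^-1 * n)))| <=
  c * s * expR (rho / 4) * `|g^-1 * (g1 * expR (- 2^-1 * n))| +
  c ^+ 2 / g * s * S * expR (- ((1 - e) * mehler_rate r * rho)) *
    expR (- (e * mehler_rate r) * n).
Proof.
move=> r0 r1 e0 e1 n0 g0 c0 s0 S0 hr h1; rewrite normrM.
have r10 : 0 < 1 + r by rewrite addr_gt0.
have k0 : 0 < mehler_rate r by rewrite divr_gt0 ?subr_gt0// mulr_gt0.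
have cs0 : 0 <= c ^+ 2 / g * s * S.
  by rewrite !mulr_ge0 ?invr_ge0// ltW.
set w := expR (- 2^-1 * n); have w0 : 0 <= w by exact: expR_ge0.
have [nr|nr] := leP n rho.
  rewrite (@le_trans _ _ (c * s * expR (rho / 4) * `|g^-1 * (g1 * w)|))//; last first.
    by rewrite lerDl mulr_ge0 ?expR_ge0// mulr_ge0 ?expR_ge0.
  rewrite ler_wpM2r// (le_trans hr)// ler_wpM2l ?mulr_ge0// ler_expR.
  have q1 : r / (2 * (1 + r)) <= 4^-1.
    by rewrite ler_pdivrMr ?mulr_gt0//; lra.
  have q0 : 0 <= r / (2 * (1 + r)) by rewrite divr_ge0 ?mulr_ge0// ltW.
  rewrite [rho / 4]mulrC (@le_trans _ _ (4^-1 * n))//; first by rewrite ler_wpM2r.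
  by rewrite ler_wpM2l.
set h := (X in _ <= _ + X); rewrite (@le_trans _ _ h)//; last first.
  by rewrite lerDr !mulr_ge0 ?expR_ge0.
rewrite !normrM (ger0_norm w0) [`|g^-1|]gtr0_norm ?invr_gt0//.
move: hr h1; set ex := expR (r / _ * _) => hr h1.
rewrite (@le_trans _ _ ((c * s * ex) * (g^-1 * ((c * S * ex) * w))))//.
  apply: ler_pM => //; first by rewrite !mulr_ge0// invr_ge0 ltW.
  by rewrite ler_wpM2l ?invr_ge0 ?(ltW g0)// ler_wpM2r.
rewrite /h (_ : _ * (_ * _) = c ^+ 2 / g * s * S * (ex * ex * w)); last by ring.
rewrite -[leRHS]mulrA ler_wpM2l// -!expRD ler_expR.
rewrite [leLHS](_ : _ = - mehler_rate r * n); last first.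
  by rewrite /mehler_rate; field; rewrite gt_eqF.
(* The share [1 - e] of the decay is evaluated at the cutoff; the share [e] is kept so that the tail
   stays integrable. *)
have : (1 - e) * mehler_rate r * rho <= (1 - e) * mehler_rate r * n.
  by rewrite ler_wpM2l ?ltW// mulr_gt0// subr_gt0.
by lra.
Qed.

(** The constant of [gtrans_sqr_le]. *)
Definition mehler_const (R : realType) (d : nat) (r : R) : R :=
  gconst d 1 * gconst d ((1 + r) / (1 - r)) / gconst d (1 / (1 - r)) ^+ 2.

Lemma mehler_const_gt0 (R : realType) (d : nat) (r : R) : 0 < r -> r < 1 ->
  0 < mehler_const d r.
Proof.
move=> r0 r1; have s0 : 0 < 1 - r by rewrite subr_gt0.
have c1 : 0 < (1 + r) / (1 - r) by rewrite divr_gt0// addr_gt0.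
have c2 : 0 < 1 / (1 - r) by rewrite divr_gt0.
by apply: divr_gt0; [apply: mulr_gt0|apply: exprn_gt0]; exact: gconst_gt0.
Qed.

Lemma mehler_rate_gt0 (R : realType) (r : R) : 0 < r -> r < 1 -> 0 < mehler_rate r.
Proof.
by move=> r0 r1; rewrite divr_gt0 ?subr_gt0// mulr_gt0// addr_gt0.
Qed.

(** The exponential comes from [gmix_ge] at [e = mehler_rate r / 2], the last factor from
    integrating the remaining Gaussian decay. *)
Definition hellinger_const (R : realType) (d : nat) (M r : R) : R :=
  (gconst d 1)^-1 * mehler_const d r *
  expR (d%:R * M ^+ 2 / (2 * mehler_rate r) + d%:R * M ^+ 2 / 2) *
  gconst d (mehler_rate r).

(** * Energy against total variation, and Hellinger distance against energy *)

Section mixture_bounds.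
Context {R : realType} {d : nat}.
Notation T := (d.-tuple R).
Variables (P Q : probability T R) (V : T -> T) (M : R).
Hypotheses (mV : measurable_fun setT V) (bV : forall u i, `|tnth (V u) i| <= M).
Hypothesis M0 : 0 <= M.
Let mu := @lebesgue_tuple R d.
Let K := d%:R * M ^+ 2.
Local Notation G := (gtrans P Q V).
Local Notation E := (genergy P Q V).

Definition gdiff (x : T) : R := (gconst d 1)^-1 * (gtrans P Q V 1 x * gweight x).

(** The Gaussian mixture whose mixing law is the image of [m] under [V]. *)
Definition gmix (m : probability T R) (x : T) : R :=
  (gconst d 1)^-1 * gweight x * \int[m]_u gkernel 1 x (V u).

Lemma gmix_diff x : gmix P x - gmix Q x = gdiff x.
Proof. by rewrite /gmix /gdiff /gtrans /nu; ring. Qed.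

Local Opaque genergy gtrans.

Lemma genergy_ge0 s : 0 <= s -> 0 <= E s.
Proof.
by move=> s0; rewrite -(sqr_sqrtr s0); exact: (genergy_sqr_ge0 P Q mV bV M0).
Qed.

Let gtrans_le (a b r : R) x : a ^+ 2 = r -> 0 < r -> r < 1 ->
  `|G (a * b) x| <= Num.sqrt (mehler_const d r) * Num.sqrt (E (b ^+ 2)) *
     expR (r / (2 * (1 + r)) * dotp x x).
Proof.
move=> ar r0 r1.
have C0 := ltW (mehler_const_gt0 d r0 r1).
have E0 : 0 <= E (b ^+ 2) by rewrite genergy_ge0// sqr_ge0.
rewrite -(@ler_pXn2r _ 2)// ?nnegrE ?mulr_ge0 ?sqrtr_ge0 ?expR_ge0//.
rewrite real_normK ?num_real// 2!exprMn sqr_sqrtr// sqr_sqrtr//.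
apply: (le_trans (gtrans_sqr_le P Q mV bV M0 b x ar r0 r1)).
rewrite le_eqVlt; apply/orP; left; apply/eqP; congr (_ * _).
by rewrite expr2 -expRD; congr expR; field; rewrite gt_eqF// addr_gt0.
Qed.

Lemma gtrans_le_r r x : 0 < r -> r < 1 ->
  `|G r x| <= Num.sqrt (mehler_const d r) * Num.sqrt (E r) *
     expR (r / (2 * (1 + r)) * dotp x x).
Proof.
move=> r0 r1; have ar := sqr_sqrtr (ltW r0).
by have := gtrans_le (Num.sqrt r) x ar r0 r1; rewrite -expr2 ar.
Qed.

(** Take $a = \sqrt r$ and $b = 1/\sqrt r$, so that $ab = 1$ and $b^2 = 1/r$: this brings in the
    energy at an argument above one. *)
Lemma gtrans_le_1 r x : 0 < r -> r < 1 ->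
  `|G 1 x| <= Num.sqrt (mehler_const d r) * Num.sqrt (E r^-1) *
     expR (r / (2 * (1 + r)) * dotp x x).
Proof.
move=> r0 r1; have ar := sqr_sqrtr (ltW r0).
have := gtrans_le (Num.sqrt r)^-1 x ar r0 r1.
by rewrite mulfV ?exprVn ?ar// gt_eqF// sqrtr_gt0.
Qed.

Lemma integrable_gdiff : mu.-integrable setT (EFin \o gdiff).
Proof.
have C0 : (0 : R) < 4^-1 by rewrite invr_gt0.
suff h : mu.-integrable setT (EFin \o (fun x => gtrans P Q V 1 x * gweight x)).
  exact: (integrableZl measurableT (gconst d 1)^-1 h).
apply: (le_integrable measurableT _ _
  (integrable_gauss0 (2 * expR (1 ^+ 2 / (4 * 4^-1) * K)) C0)).
  by apply/measurable_EFinP; exact: measurable_gtrans_weight mV bV M0 _.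
move=> x _ /=; rewrite lee_fin (le_trans (gtrans_weight_bound P Q mV bV M0 1 x))//.
exact: ler_norm.
Qed.

(** By Parseval, [E r] is the integral of [gtrans r] against the difference of the mixtures;
    [cutoff_pointwise] bounds the integrand. *)
Lemma genergy_le_cutoff (r e rho : R) : 0 < r -> r < 1 -> 0 < e -> e < 1 -> 0 <= rho ->
  E r <= Num.sqrt (mehler_const d r) * Num.sqrt (E r) * expR (rho / 4) *
           \int[mu]_x `|gdiff x| +
         (mehler_const d r / gconst d 1 * gconst d (2 * (e * mehler_rate r))) *
           Num.sqrt (E r) * Num.sqrt (E r^-1) * expR (- ((1 - e) * mehler_rate r * rho)).
Proof.
move=> r0 r1 e0 e1 rho0.
have k0 := mehler_rate_gt0 r0 r1; have C0 := mehler_const_gt0 d r0 r1.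
pose c := Num.sqrt (mehler_const d r); pose s := Num.sqrt (E r); pose S := Num.sqrt (E r^-1).
pose k := mehler_rate r; pose X := expR (- ((1 - e) * k * rho)).
suff: E r <= c * s * expR (rho / 4) * \int[mu]_x `|gdiff x| +
    (mehler_const d r / gconst d 1 * gconst d (2 * (e * k))) * s * S * X by exact.
have g0 : 0 < gconst (R := R) d 1 by exact: gconst_gt0.
have cc : c ^+ 2 = mehler_const d r by rewrite sqr_sqrtr// ltW.
pose h (x : T) := (c ^+ 2 / gconst d 1 * s * S * X) * expR (- (e * k) * dotp x x).
have ek0 : 0 < e * k by rewrite mulr_gt0.
have ih : mu.-integrable setT (EFin \o h) by exact: integrable_gauss0.
have iD : mu.-integrable setT (EFin \o (fun x => `|gdiff x|)).
  exact: (integrable_norm integrable_gdiff).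
have iD' : mu.-integrable setT (EFin \o (fun x => c * s * expR (rho / 4) * `|gdiff x|)).
  exact: (integrableZl measurableT _ iD).
have Er : E r = \int[mu]_x (G r x * gdiff x).
  have i := integrable_gtransM P Q mV bV M0 r 1.
  transitivity ((gconst d 1)^-1 * \int[mu]_x (G r x * (G 1 x * gweight x))).
    by rewrite (Rintegral_gtransM P Q mV bV M0 r 1) mulr1 mulrA mulVf ?mul1r// gt_eqF.
  by rewrite -RintegralZl//; apply: eq_Rintegral => x _; rewrite /gdiff; ring.
have iGD : mu.-integrable setT (EFin \o (fun x => G r x * gdiff x)).
  have := integrableZl measurableT (gconst d 1)^-1 (integrable_gtransM P Q mV bV M0 r 1).
  by apply: eq_integrable => // x _; rewrite /= -EFinM /gdiff; congr EFin; ring.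
have eqh : \int[mu]_x h x = (mehler_const d r / gconst d 1 * gconst d (2 * (e * k))) * s * S * X.
  by rewrite Rintegral_gauss0// cc; ring.
suff le_int : E r <= c * s * expR (rho / 4) * \int[mu]_x `|gdiff x| + \int[mu]_x h x.
  by apply: (le_trans le_int); rewrite lerD2l eqh.
rewrite [leLHS]Er -RintegralZl// -RintegralD//.
apply: le_Rintegral => // [|x _]; first exact: (integrableD measurableT iD' ih).
rewrite (le_trans (ler_norm _))//.
have aim := cutoff_pointwise rho r0 r1 e0 e1 (dotp_ge0 x) g0 (sqrtr_ge0 _) (sqrtr_ge0 _)
  (sqrtr_ge0 _) (gtrans_le_r x r0 r1) (gtrans_le_1 x r0 r1).
exact: aim.
Qed.

Lemma integrable_gkernel (m : probability T R) x :
  m.-integrable setT (EFin \o (fun u => gkernel 1 x (V u))).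
Proof. exact: (nu_adm_integrable m (nu_adm_gkernel mV bV M0 1 x)). Qed.

(** Young's inequality with coefficient [-1] bounds the kernel below uniformly in [u], and averaging
    over [m] keeps the bound. *)
Lemma gmix_ge (m : probability T R) (e : R) x : 0 < e ->
  (gconst d 1)^-1 * gweight x * (expR (- (K / (4 * e) + K / 2)) * expR (- e * dotp x x))
  <= gmix m x.
Proof.
move=> e0; have c0 : 0 <= (gconst d 1)^-1 * gweight x.
  by rewrite mulr_ge0 ?expR_ge0// invr_ge0 ltW// gconst_gt0.
rewrite ler_wpM2l//.
rewrite -expRD.
have -> : expR (- (K / (4 * e) + K / 2) + - e * dotp x x) =
    \int[m]_u expR (- (K / (4 * e) + K / 2) + - e * dotp x x).
  by rewrite Rintegral_cst// [X in fine X](@probability_setT _ _ _ m) mulr1.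
apply: le_Rintegral => //; first exact: finite_measure_integrable_cst.
  exact: integrable_gkernel.
move=> u _; rewrite ler_expR.
have := dotp_young (-1) x (V u) e0.
have uK : dotp (V u) (V u) <= K.
  exact: (le_trans (ler_norm _) (normr_dotpV bV _ _ M0)).
have : (-1) ^+ 2 / (4 * e) * dotp (V u) (V u) <= K / (4 * e).
  by rewrite sqrrN expr1n mul1r mulrC ler_wpM2r// invr_ge0 mulr_ge0// ltW.
by rewrite expr1n; lra.
Qed.

Lemma gmix_gt0 (m : probability T R) x : 0 < gmix m x.
Proof.
apply: lt_le_trans (gmix_ge m x (@ltr01 R)).
by rewrite !mulr_gt0 ?expR_gt0// invr_gt0 gconst_gt0.
Qed.

Lemma measurable_gmix (m : probability T R) : measurable_fun setT (gmix m).
Proof.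
apply: measurable_funM; first by apply: measurable_funM => //; exact: measurable_gweight.
apply/measurable_EFinP.
rewrite (_ : EFin \o _ = fubini_F m (fun z : T * T => (gkernel 1 z.1 (V z.2))%:E)).
  apply: measurable_fun_fubini_tonelli_F => [|z]; last by rewrite lee_fin expR_ge0.
  by apply/measurable_EFinP; exact: measurable_gkernel.
apply/funext => x; rewrite /= /Rintegral fineK// integrable_fin_num//.
exact: integrable_gkernel.
Qed.

(** Factor $p - q$ as a difference of squares and use $(\sqrt p + \sqrt q)^2 \ge p$. *)
Lemma sqrt_sub_sqr_le (p q : R) : 0 < p -> 0 <= q ->
  (Num.sqrt p - Num.sqrt q) ^+ 2 <= (p - q) ^+ 2 / p.
Proof.
move=> p0 q0; rewrite ler_pdivlMr//.
have -> : (p - q) ^+ 2 =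
    (Num.sqrt p - Num.sqrt q) ^+ 2 * (Num.sqrt p + Num.sqrt q) ^+ 2.
  by rewrite -exprMn -subr_sqr !sqr_sqrtr// ltW.
rewrite ler_wpM2l ?sqr_ge0// -{1}(sqr_sqrtr (ltW p0)).
by rewrite ler_pXn2r ?nnegrE ?addr_ge0 ?sqrtr_ge0// lerDl sqrtr_ge0.
Qed.

(** The integrand is at most $(p-q)^2/p$. With [k = mehler_rate r], this ratio decays like
    $\exp(-k|x|^2)$ up to the loss $\exp(k|x|^2/2)$ in the lower bound for $p$. *)
Lemma hellinger_gmix_le r : 0 < r -> r < 1 ->
  \int[mu]_x (Num.sqrt (gmix P x) - Num.sqrt (gmix Q x)) ^+ 2 <=
  hellinger_const d M r * E r^-1.
Proof.
move=> r0 r1; have k0 := mehler_rate_gt0 r0 r1.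
set k := mehler_rate r in k0 *.
have C0 := mehler_const_gt0 d r0 r1.
have g0 : 0 < gconst (R := R) d 1 by exact: gconst_gt0.
have k20 : 0 < k / 2 by rewrite divr_gt0.
have E0 : 0 <= E r^-1 by rewrite genergy_ge0// invr_ge0 ltW.
set L := expR (K / (2 * k) + K / 2).
pose C := (gconst d 1)^-1 * mehler_const d r * L * E r^-1.
have ig0 : 0 <= (gconst (R := R) d 1)^-1 by rewrite invr_ge0 ltW.
have C00 : 0 <= C.
  by apply: mulr_ge0 E0; apply: mulr_ge0 (expR_ge0 _); apply: mulr_ge0 ig0 (ltW C0).
pose h (x : T) := C * expR (- (k / 2) * dotp x x).
have ih : mu.-integrable setT (EFin \o h) by exact: integrable_gauss0.
have le_h x : (Num.sqrt (gmix P x) - Num.sqrt (gmix Q x)) ^+ 2 <= h x.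
  have p0 := gmix_gt0 P x; have q0 := gmix_gt0 Q x.
  rewrite (le_trans (sqrt_sub_sqr_le p0 (ltW q0)))// gmix_diff.
  have pge := gmix_ge P x k20.
  rewrite ler_pdivrMr// (@le_trans _ _ (h x * ((gconst d 1)^-1 * gweight x *
    (expR (- (K / (4 * (k / 2)) + K / 2)) * expR (- (k / 2) * dotp x x)))))//; last first.
    by rewrite ler_wpM2l// mulr_ge0 ?expR_ge0.
  have G1 := gtrans_le_1 x r0 r1.
  have {G1} : G 1 x ^+ 2 <= mehler_const d r * E r^-1 * expR (r / (1 + r) * dotp x x).
    rewrite -(real_normK (num_real (G 1 x))).
    apply: (le_trans (lerXn2r 2 _ _ G1)); rewrite ?nnegrE ?mulr_ge0 ?sqrtr_ge0 ?expR_ge0//.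
    rewrite 2!exprMn !sqr_sqrtr ?(ltW C0)// le_eqVlt; apply/orP; left; apply/eqP.
    by congr (_ * _); rewrite expr2 -expRD; congr expR; field; rewrite gt_eqF// addr_gt0.
  move=> G1; rewrite /gdiff.
  have -> : ((gconst d 1)^-1 * (G 1 x * gweight x)) ^+ 2 =
    (gconst d 1)^-1 ^+ 2 * gweight x ^+ 2 * G 1 x ^+ 2 by ring.
  rewrite (le_trans (ler_wpM2l _ G1)) ?mulr_ge0 ?exprn_ge0 ?expR_ge0 ?invr_ge0 ?(ltW g0)//.
  have -> : expR (- (K / (4 * (k / 2)) + K / 2)) = L^-1.
    by rewrite -expRN; congr expR; field; rewrite gt_eqF.
  have L0 : 0 < L by exact: expR_gt0.
  set w := gweight x; set X := expR (- _ * _); set Y := expR _.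
  have -> : h x * ((gconst d 1)^-1 * w * (L^-1 * X)) =
      (gconst d 1)^-1 ^+ 2 * mehler_const d r * E r^-1 * w * (X * X).
    by rewrite /h -/X /C; field; rewrite gt_eqF ?gt_eqF.
  have -> : (gconst d 1)^-1 ^+ 2 * w ^+ 2 * (mehler_const d r * E r^-1 * Y) =
      (gconst d 1)^-1 ^+ 2 * mehler_const d r * E r^-1 * w * (w * Y) by ring.
  rewrite le_eqVlt; apply/orP; left; apply/eqP; congr (_ * _).
  rewrite /w /X /Y -!expRD; congr expR; rewrite /k /mehler_rate; field.
  by rewrite gt_eqF// addr_gt0.
rewrite (_ : _ * E r^-1 = \int[mu]_x h x); last first.
  rewrite Rintegral_gauss0// /hellinger_const -/k -/K -/L /C.
  rewrite (_ : 2 * (k / 2) = k); last by field.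
  by ring.
apply: le_Rintegral => //.
apply: (le_integrable measurableT _ _ ih).
  apply/measurable_EFinP; apply: measurable_funX; apply: measurable_funB.
    by apply: measurableT_comp; [exact: (continuous_measurable_fun (@sqrt_continuous R))|exact: measurable_gmix].
  by apply: measurableT_comp; [exact: (continuous_measurable_fun (@sqrt_continuous R))|exact: measurable_gmix].
move=> x _; rewrite /= lee_fin ger0_norm ?sqr_ge0// (le_trans (le_h x))//.
exact: ler_norm.
Qed.

End mixture_bounds.

(** * Choice of the degree, the cutoff radius and the constants *)

(* The Taylor degree [N] is about [(2 + delta / 2) L / log L] with
   [L = log (1 / t)]: then [N!] exceeds [t^-2] by more than any geometric factor,
   while [exp ((1 + eta) N)] stays below [t^(- alpha t)]. *)
Lemma taylor_degree (R : realType) (A B L delta : R) :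
  0 < A -> 0 < B -> 0 < L -> 0 < delta ->
  exists2 t0 : R, 0 < t0 & forall t, 0 < t -> t < t0 -> exists N : nat,
    A * expR ((1 + delta / (8 + 2 * delta)) * N%:R) * t +
      B * Num.sqrt (L ^+ N.+1 / N.+1`!%:R) <= t `^ (- alpha delta t) * t.
Proof.
move=> A0 B0 L0 d0.
(* [c1] solves [(2 + delta / 2) * (1 - c1) = 2]. The threshold [y1] ensures [ln y + k <= c1 * y],
   and [y2] makes [ln (A + B)] at most [delta / 4 * (Lg / y)]. *)
pose k := ln L + 1; pose c1 := delta / (4 + delta).
have c10 : 0 < c1 by rewrite divr_gt0// addr_gt0.
pose y1 := (k - 1 - ln (c1 / 2)) * (2 / c1); pose y2 := 2 * (4 / delta) * ln (A + B).
pose y0 := 1 + `|y1| + `|y2|.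
exists (expR (- expR y0)); first exact: expR_gt0.
move=> t t0 tt0; pose Lg := ln t^-1; pose y := ln Lg.
have LgE : Lg = - ln t by rewrite /Lg lnV.
have LgY : expR y0 < Lg.
  by rewrite LgE ltrNr -[ltRHS]expRK ltr_ln ?posrE ?expR_gt0.
have Lg0 : 0 < Lg by exact: lt_trans (expR_gt0 _) LgY.
have yy0 : y0 < y by rewrite /y -[ltLHS]expRK ltr_ln ?posrE ?expR_gt0.
have y00 : 1 <= y0 by rewrite /y0 -addrA lerDl addr_ge0.
have y1y : y1 <= y.
  by rewrite (le_trans (ler_norm _))// (le_trans _ (ltW yy0))// /y0 addrAC lerDr addr_ge0.
have y2y : y2 <= y.
  by rewrite (le_trans (ler_norm _))// (le_trans _ (ltW yy0))// /y0 lerDr addr_ge0.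
have yp : 1 < y by exact: le_lt_trans yy0.
have yp0 : 0 < y by exact: lt_trans yp.
have yn0 : y != 0 by rewrite gt_eqF.
have eyL : expR y = Lg by rewrite lnK.
have lny : ln y + k <= c1 * y.
  have c120 : 0 < c1 / 2 by rewrite divr_gt0.
  have c1y : 0 < c1 / 2 * y by rewrite mulr_gt0.
  have h1 : ln (c1 / 2 * y) <= c1 / 2 * y - 1.
    have := expR_ge1Dx (ln (c1 / 2 * y)); rewrite lnK ?posrE//; lra.
  rewrite lnM ?posrE// in h1.
  have h2 : k - 1 - ln (c1 / 2) <= c1 / 2 * y.
    have : y1 * (c1 / 2) <= y * (c1 / 2) by rewrite ler_wpM2r// divr_ge0// ltW.
    have -> : y1 * (c1 / 2) = k - 1 - ln (c1 / 2) by rewrite /y1; field; rewrite gt_eqF.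
    by rewrite [y * _]mulrC.
  by lra.
have Ly : y / 2 <= Lg / y.
  rewrite ler_pdivlMr// -eyL.
  have := expR_ge1Dxn 1 (ltW yp0); rewrite -[2`!]/2%N.
  by rewrite expr2; lra.
have lnAB : ln (A + B) <= delta / 4 * (Lg / y).
  have : delta / 4 * (y / 2) <= delta / 4 * (Lg / y).
    by rewrite ler_wpM2l// divr_ge0// ltW.
  apply: le_trans.
  have : delta / 8 * y2 <= delta / 8 * y by rewrite ler_wpM2l// divr_ge0// ltW.
  have -> : delta / 8 * y2 = ln (A + B) by rewrite /y2; field; rewrite gt_eqF.
  by lra.
pose x := (2 + delta / 2) * (Lg / y).
have d20 : 0 < 2 + delta / 2 by rewrite addr_gt0// divr_gt0.
have x0 : 0 < x by rewrite mulr_gt0// divr_gt0.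
have xy : x * (y - c1 * y) <= x * (y - ln y - k).
  by rewrite ler_wpM2l ?(ltW x0)//; lra.
have q0 : 0 <= y - ln y - k.
  have c11 : c1 < 1 by rewrite ltr_pdivrMr ?addr_gt0//; lra.
  have : c1 * y <= y by rewrite ger_pMl// ltW.
  by lra.
have lnABx : ln (A + B) + (2 + delta * 3 / 4) * (Lg / y) <= (2 + delta) * (Lg / y).
  by lra.
(* [N <= x] controls the exponential factor, [x <= N.+1] the factorial. *)
pose N : nat := Num.truncn x. exists N.
have Nx : N%:R <= x by rewrite truncn_le// ltW.
have xN : x <= N.+1%:R by rewrite ltW// truncnS_gt.
have n0 : 0 < N.+1%:R :> R by [].
(* Below [t0] one has [Lg > e], so the maximum inside [alpha] is [Lg]. *)
have -> : t `^ (- alpha delta t) = expR ((2 + delta) * (Lg / y)).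
  rewrite /powR gt_eqF// /alpha max_l; last first.
    by rewrite -/Lg (le_trans _ (ltW LgY))// ler_expR.
  by congr expR; rewrite -/Lg -/y LgE; field.
have tail : Num.sqrt (L ^+ N.+1 / N.+1`!%:R) <= t.
  have tE : t ^+ 2 = expR (- (2 * Lg)).
    by rewrite LgE mulrN opprK expRM_natl lnK.
  rewrite -[leRHS](ger0_norm (ltW t0)) -sqrtr_sqr ler_wsqrtr// tE.
  set n := N.+1 in xN n0 *.
  (* $n! \ge (n/e)^n$, from a single term of the series of $e^n$. *)
  have fact_ge : n%:R ^+ n / expR n%:R <= n`!%:R :> R.
    rewrite ler_pdivrMr ?expR_gt0// mulrC -ler_pdivrMr ?ltr0n ?fact_gt0//.
    by apply: le_trans (@expR_ge1Dxn R n%:R N (ltW n0)); rewrite lerDr ler01.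
  rewrite (@le_trans _ _ (L ^+ n / (n%:R ^+ n / expR n%:R)))//.
    rewrite ler_wpM2l ?exprn_ge0 ?(ltW L0)// lef_pV2// posrE ?ltr0n ?fact_gt0//.
    by rewrite divr_gt0 ?expR_gt0// exprn_gt0.
  have -> : L ^+ n / (n%:R ^+ n / expR n%:R) = expR (- (n%:R * (ln n%:R - k))).
    rewrite -[in LHS](lnK (L0 : L \is Num.pos)) -[in X in X / expR _](lnK (n0 : n%:R \is Num.pos)).
    by rewrite -!expRM_natl -!expRB; congr expR; rewrite /k; ring.
  rewrite ler_expR lerN2.
  have lnn : y - ln y <= ln n%:R.
    rewrite (@le_trans _ _ (ln x))//; last by rewrite ler_ln.
    rewrite /x lnM ?posrE ?divr_gt0// ln_div ?posrE// -/y lerDr ln_ge0//.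
    by rewrite -[leLHS]addr0 lerD// ?ler1n// divr_ge0// ltW.
  rewrite (@le_trans _ _ (x * (y - ln y - k)))//; last first.
    by apply: ler_pM => //; [exact: ltW|rewrite lerD2r].
  apply: le_trans xy; rewrite le_eqVlt; apply/orP; left; apply/eqP.
  rewrite /x /c1; field; rewrite yn0 gt_eqF// addr_gt0//.
have AB0 : 0 < A + B by rewrite addr_gt0.
(* [2 + delta * 3 / 4] is [2 + delta / 2] times the coefficient of [N]; the remaining [delta / 4]
   absorbs [A + B]. *)
rewrite (@le_trans _ _ ((A + B) * expR ((2 + delta * 3 / 4) * (Lg / y)) * t))//.
  set ex := expR ((2 + _) * _).
  have ex1 : 1 <= ex.
    by rewrite -expR0 ler_expR mulr_ge0 ?divr_ge0 ?addr_ge0 ?mulr_ge0 ?divr_ge0// ltW.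
  rewrite [leRHS](_ : _ = A * ex * t + B * (ex * t)); last by ring.
  apply: lerD.
    rewrite ler_wpM2r ?(ltW t0)// ler_wpM2l ?(ltW A0)// ler_expR.
    rewrite (_ : (2 + delta * 3 / 4) * (Lg / y) = (1 + delta / (8 + 2 * delta)) * x).
      by rewrite ler_wpM2l// addr_ge0// divr_ge0 ?addr_ge0 ?mulr_ge0// ltW.
    by rewrite /x; field; rewrite yn0 gt_eqF// addr_gt0 ?mulr_gt0.
  rewrite ler_wpM2l ?(ltW B0)// (le_trans tail)// ler_peMl// ltW//.
rewrite ler_wpM2r ?(ltW t0)// -{1}(lnK (AB0 : A + B \is Num.pos)) -expRD ler_expR.
exact: lnABx.
Qed.

(** Here [s] and [S] are the roots of the energies at [r] and [r^-1], and [q] is $r^{-N}$. Dividing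
    by [s] and inserting [S <= q * s + tau], the condition [A * X * q <= 2^-1] absorbs the tail
    term. *)
Lemma cutoff_combine (R : realType) (s S q a A X tau : R) :
  0 <= s -> 0 <= S -> 0 <= q -> 0 <= a -> 0 <= A -> 0 <= X -> 0 <= tau ->
  s ^+ 2 <= s * a + A * s * S * X -> S ^+ 2 <= q ^+ 2 * s ^+ 2 + tau ^+ 2 ->
  A * X * q <= 2^-1 -> S <= 2 * (q * a) + 2 * tau.
Proof.
move=> s0 S0 q0 a0 A0 X0 t0 hs hS hq.
have Sle : S <= q * s + tau.
  rewrite -(@ler_pXn2r _ 2)// ?nnegrE ?addr_ge0 ?mulr_ge0// (le_trans hS)//.
  have -> : (q * s + tau) ^+ 2 = q ^+ 2 * s ^+ 2 + tau ^+ 2 + 2 * (q * s * tau) by ring.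
  by rewrite lerDl mulr_ge0// mulr_ge0// mulr_ge0.
have [s00|sn0] := eqVneq s 0.
  have : S <= tau by move: Sle; rewrite s00 mulr0 add0r.
  have : 0 <= q * a by rewrite mulr_ge0.
  by lra.
have sp : 0 < s by rewrite lt_neqAle eq_sym sn0.
have h1 : s <= a + A * S * X.
  rewrite -(ler_pM2l sp) -expr2 (le_trans hs)// le_eqVlt; apply/orP; left; apply/eqP.
  by ring.
have AX0 : 0 <= A * X by rewrite mulr_ge0.
have h2 : A * X * S <= A * X * q * s + A * X * tau.
  by rewrite [leRHS](_ : _ = A * X * (q * s + tau)); [rewrite ler_wpM2l|ring].
have h3 : A * X * q * s <= 2^-1 * s by rewrite ler_wpM2r.
have h4 : s <= 2 * a + 2 * (A * X * tau) by lra.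
have h5 : q * s <= q * (2 * a + 2 * (A * X * tau)) by rewrite ler_wpM2l.
have h6 : A * X * q * tau <= 2^-1 * tau by rewrite ler_wpM2r.
have -> : 2 * (q * a) + 2 * tau = q * (2 * a) + 2 * (2^-1 * tau) + tau by field.
have h7 : q * (2 * a + 2 * (A * X * tau)) = q * (2 * a) + 2 * (A * X * q * tau) by ring.
by lra.
Qed.

(** The left side is the exponential cost per degree. As [e] tends to 0, the logarithm behaves like
    [e] and the bracket like [1 / e], so the product tends to 1. *)
Lemma mehler_exponent_le (R : realType) (eta e : R) :
  0 < e -> e <= 2^-1 -> 8 * e <= eta ->
  ln (1 - e)^-1 * (1 + (4 * ((1 - e) * mehler_rate (1 - e)))^-1) <= 1 + eta.
Proof.
move=> e0 e2 ee.
have r0 : 0 < 1 - e by lra.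
have rn0 : 1 - e != 0 by rewrite gt_eqF.
pose y := (1 - e)^-1.
have y0 : 0 < y by rewrite invr_gt0.
have y1 : y <= 1 + 2 * e.
  rewrite -[y]mul1r ler_pdivrMr//; nra.
have lnle : ln y <= y * e.
  have := expR_ge1Dx (ln y); rewrite lnK ?posrE//.
  have -> : y * e = y - 1 by rewrite /y; field.
  by lra.
have e1n0 : 1 + (1 - e) != 0 by rewrite gt_eqF// addr_gt0.
have en0 : e != 0 by rewrite gt_eqF.
have -> : (4 * ((1 - e) * mehler_rate (1 - e)))^-1 = (2 - e) / (2 * e) * y.
  rewrite /mehler_rate /y; field; rewrite rn0 en0/=.
  by apply: lt0r_neq0; lra.
have f0 : 0 <= 1 + (2 - e) / (2 * e) * y.
  by rewrite addr_ge0// mulr_ge0 ?(ltW y0)// divr_ge0 ?mulr_ge0//; lra.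
rewrite (le_trans (ler_wpM2r f0 lnle))//.
have -> : y * e * (1 + (2 - e) / (2 * e) * y) = e * y + (1 - e / 2) * y ^+ 2 by field.
have y2 : y ^+ 2 <= (1 + 2 * e) ^+ 2 by rewrite lerXn2r ?nnegrE; lra.
have h1 : (1 - e / 2) * y ^+ 2 <= (1 - e / 2) * (1 + 2 * e) ^+ 2.
  by rewrite ler_wpM2l//; lra.
have h2 : e * y <= e * (1 + 2 * e) by rewrite ler_wpM2l// ltW.
apply: (le_trans (lerD h2 h1)).
by nra.
Qed.

(** [Er], [Ei] and [t] stand for the energies at [r] and [r^-1] and the $L^1$ distance. The same
    small [e] serves as [1 - r] and as the share of decay kept in the tail. *)
Lemma energy_parameters (R : realType) (d : nat) (K eta : R) : 0 <= K -> 0 < eta ->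
  exists r e A B L : R, [/\ 0 < r < 1, 0 < e < 1, 0 < A, 0 < B & 0 < L /\
    forall (N : nat) (Er Ei t : R), 0 <= Er -> 0 <= Ei -> 0 <= t ->
      (forall rho, 0 <= rho ->
        Er <= Num.sqrt (mehler_const d r) * Num.sqrt Er * expR (rho / 4) * t +
          (mehler_const d r / gconst d 1 * gconst d (2 * (e * mehler_rate r))) *
          Num.sqrt Er * Num.sqrt Ei * expR (- ((1 - e) * mehler_rate r * rho))) ->
      Ei <= (r^-1) ^+ N.*2 * Er + 8 * ((K / r) ^+ N.+1 / N.+1`!%:R * expR (K / r)) ->
      Num.sqrt Ei <= A * expR ((1 + eta) * N%:R) * t +
        B * Num.sqrt (L ^+ N.+1 / N.+1`!%:R)].
Proof.
move=> K0 eta0.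
pose e := Num.min 2^-1 (eta / 8).
have e0 : 0 < e by rewrite lt_min invr_gt0 ltr0n/= divr_gt0.
have e2 : e <= 2^-1 by rewrite ge_min lexx.
have ee : 8 * e <= eta.
  have : e <= eta / 8 by rewrite ge_min lexx orbT.
  by lra.
have e1 : e < 1 by lra.
pose r := 1 - e.
have r0 : 0 < r by rewrite /r; lra.
have r1 : r < 1 by rewrite /r; lra.
pose k := mehler_rate r.
have k0 : 0 < k by exact: mehler_rate_gt0.
have C0 := mehler_const_gt0 d r0 r1.
pose c := Num.sqrt (mehler_const d r).
pose A1 := mehler_const d r / gconst d 1 * gconst d (2 * (e * k)).
have A10 : 0 <= A1.
  have g1 : 0 < gconst d (1 : R) by exact: gconst_gt0.
  have g2 : 0 < gconst d (2 * (e * k)) by apply: gconst_gt0; rewrite mulr_gt0// mulr_gt0.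
  by apply: mulr_ge0 (ltW g2); apply: divr_ge0; exact: ltW.
pose A2 := A1 + 1.
have A20 : 0 < A2 by rewrite /A2; lra.
pose l2 := ln (2 * A2).
have l20 : 0 <= l2 by rewrite ln_ge0// /A2; lra.
have r0' : 0 < r^-1 by rewrite invr_gt0.
have lr0 : 0 <= ln r^-1 by rewrite ln_ge0// invf_ge1// ltW.
pose ek := (1 - e) * k.
have ek0 : 0 < ek by rewrite mulr_gt0// subr_gt0.
pose L := K / r + 1.
have L1 : K / r <= L by rewrite /L lerDl.
have L0 : 0 < L by rewrite ltr_wpDl ?divr_ge0// ltW.
(* The factor [expR (l2 / (4 * ek))] is the part of [expR (rho / 4)] independent of [N]. *)
exists r, e, (2 * ((c + 1) * expR (l2 / (4 * ek)))), (2 * Num.sqrt (8 * expR L)), L; split.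
- by rewrite r0 r1.
- by rewrite e0 e1.
- by rewrite mulr_gt0// mulr_gt0 ?expR_gt0// ltr_wpDl ?sqrtr_ge0.
- by rewrite mulr_gt0// sqrtr_gt0 mulr_gt0// expR_gt0.
split=> // N Er Ei t Er0 Ei0 t0 cut tay.
(* This radius makes the tail factor exactly $r^N/(2 A_2)$, whence [AXq]. *)
pose rho := (N%:R * ln r^-1 + l2) / ek.
have rho0 : 0 <= rho.
  by apply: divr_ge0 (ltW ek0); apply: addr_ge0 l20; apply: mulr_ge0.
pose F := L ^+ N.+1 / N.+1`!%:R.
have F0 : 0 <= F by rewrite divr_ge0 ?exprn_ge0 ?(ltW L0).
pose tau := Num.sqrt (8 * expR L) * Num.sqrt F.
have tau0 : 0 <= tau by rewrite mulr_ge0 ?sqrtr_ge0.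
have tau2 : 8 * ((K / r) ^+ N.+1 / N.+1`!%:R * expR (K / r)) <= tau ^+ 2.
  have eL0 : 0 <= 8 * expR L by rewrite mulr_ge0 ?expR_ge0.
  rewrite /tau [leRHS]exprMn (sqr_sqrtr eL0) (sqr_sqrtr F0) -[leRHS]mulrA ler_wpM2l//.
  rewrite mulrC; have Kr0 : 0 <= K / r by rewrite divr_ge0// ltW.
  apply: ler_pM; rewrite ?expR_ge0 ?ler_expR//; first by rewrite divr_ge0 ?exprn_ge0.
  by rewrite ler_wpM2r// lerXn2r ?nnegrE// ltW.
pose q := (r^-1) ^+ N.
have qE : q = expR (N%:R * ln r^-1) by rewrite expRM_natl lnK.
have q0 : 0 <= q by rewrite exprn_ge0// ltW.
pose X := expR (- (ek * rho)).
have AXq : A1 * X * q <= 2^-1.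
  have -> : X = q^-1 / (2 * A2).
    have -> : 2 * A2 = expR l2 by rewrite lnK// posrE mulr_gt0.
    rewrite qE -expRN -expRN -expRD; congr expR; rewrite /rho; field.
    by rewrite gt_eqF.
  have qn0 : q != 0 by rewrite qE gt_eqF// expR_gt0.
  have An0 : A2 != 0 by rewrite gt_eqF.
  have -> : A1 * (q^-1 / (2 * A2)) * q = A1 / A2 * 2^-1 by field; rewrite ?qn0 ?An0.
  by rewrite ler_piMl// ler_pdivrMr// mul1r /A2 lerDl.
have a0 : 0 <= c * expR (rho / 4) * t.
  by rewrite mulr_ge0// mulr_ge0 ?sqrtr_ge0 ?expR_ge0.
have hs : Num.sqrt Er ^+ 2 <= Num.sqrt Er * (c * expR (rho / 4) * t) +
    A1 * Num.sqrt Er * Num.sqrt Ei * X.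
  rewrite [leLHS](sqr_sqrtr Er0) (le_trans (cut rho rho0))// lerD//.
  by rewrite le_eqVlt; apply/orP; left; apply/eqP; rewrite -/c; ring.
have hS : Num.sqrt Ei ^+ 2 <= q ^+ 2 * Num.sqrt Er ^+ 2 + tau ^+ 2.
  rewrite (sqr_sqrtr Er0) (sqr_sqrtr Ei0) (le_trans tay)// lerD//.
  by rewrite /q -exprM muln2.
apply: (le_trans (cutoff_combine (sqrtr_ge0 _) (sqrtr_ge0 _) q0 a0 A10 (expR_ge0 _)
  tau0 hs hS AXq)).
apply: lerD; last by rewrite /tau mulrA.
rewrite [leLHS](_ : _ = 2 * (c * (q * expR (rho / 4))) * t); last by ring.
rewrite -[X in _ <= X * t]mulrA -[X in _ <= _ * X * t]mulrA.
rewrite (ler_wpM2r t0)// ler_wpM2l//.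
apply: ler_pM; rewrite ?sqrtr_ge0 ?lerDl//; first by rewrite mulr_ge0 ?expR_ge0.
rewrite qE -!expRD ler_expR.
have ml := mehler_exponent_le e0 e2 ee.
have hN : N%:R * (ln r^-1 * (1 + (4 * ek)^-1)) <= N%:R * (1 + eta) by rewrite ler_wpM2l.
have -> : N%:R * ln r^-1 + rho / 4 = N%:R * (ln r^-1 * (1 + (4 * ek)^-1)) + l2 / (4 * ek).
  by rewrite /rho; field; rewrite gt_eqF.
by rewrite [leRHS]addrC [(1 + eta) * _]mulrC lerD2r.
Qed.

Lemma genergy_bound (R : realType) (d : nat) (M eta : R) : 0 <= M -> 0 < eta ->
  exists r A B L : R, [/\ 0 < r < 1, 0 < A, 0 < B, 0 < L &
    forall (P Q : probability (d.-tuple R) R) (V : d.-tuple R -> d.-tuple R) (N : nat),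
      measurable_fun setT V -> (forall u i, `|tnth (V u) i| <= M) ->
      Num.sqrt (genergy P Q V r^-1) <=
        A * expR ((1 + eta) * N%:R) * \int[lebesgue_tuple d]_x `|gdiff P Q V x| +
        B * Num.sqrt (L ^+ N.+1 / N.+1`!%:R)].
Proof.
move=> M0 eta0.
have K0 : 0 <= d%:R * M ^+ 2 by rewrite mulr_ge0 ?sqr_ge0.
have [r [e [A [B [L [r01 e01 A0 B0 [L0 H]]]]]]] := energy_parameters d K0 eta0.
exists r, A, B, L; split=> // P Q V N mV bV.
have /andP[r0 r1] := r01; have /andP[e0 e1] := e01.
have ri0 : 0 <= r^-1 by rewrite invr_ge0 ltW.
apply: H.
- exact: (genergy_ge0 P Q mV bV M0 (ltW r0)).
- exact: (genergy_ge0 P Q mV bV M0 ri0).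
- exact: Rintegral_ge0.
- by move=> rho rho0; exact: genergy_le_cutoff.
- exact: genergy_le.
Qed.

(** * Retraction onto the cube *)

Section clamp.
Context {R : realType} {d : nat}.
Variable M : R.
Hypothesis M0 : 0 <= M.
Notation T := (d.-tuple R).

(** As it fixes the cube, it leaves integrals against measures supported there unchanged, while
    keeping the kernels bounded in [u]. *)
Definition clamp (u : T) : T := [tuple Num.max (- M) (Num.min M (tnth u i)) | i < d].

Lemma measurable_clamp : measurable_fun setT clamp.
Proof.
apply/measurable_fun_tnthP => i.
rewrite (_ : _ \o _ = (cst (- M)) \max ((cst M) \min (fun u : T => tnth u i))).
  apply: measurable_maxr => //; apply: measurable_minr => //; exact: measurable_tnth.
by apply/funext => u; rewrite /= tnth_mktuple.
Qed.

Lemma clamp_le u i : `|tnth (clamp u) i| <= M.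
Proof.
rewrite tnth_mktuple ler_norml le_max lexx/= ge_max ge_min lexx/= andbT.
by rewrite ge0_cp.
Qed.

Lemma clamp_id u : cube M u -> clamp u = u.
Proof.
move=> uM; apply: eq_from_tnth => i; rewrite tnth_mktuple.
have := uM i; rewrite in_itv/= => /andP[Mu uM'].
by rewrite min_r// max_r.
Qed.

Lemma measurable_cube : measurable (cube M : set T).
Proof.
rewrite (_ : cube M = \bigcap_(i in [set: 'I_d]) ((@tnth d R ^~ i) @^-1` `[- M, M]%classic)).
  apply: fin_bigcap_measurable => // i _; rewrite -[X in measurable X]setTI.
  by apply: measurable_tnth => //; exact: measurable_itv.
by apply/seteqP; split=> x /= Hx i => [_|]; exact: Hx.
Qed.

(** Expanding $|x-u|^2$ gives the kernel; clamping alters the integrand only off the cube, on a null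
    set. *)
Lemma gauss_mixtureE (m : probability T R) : supported_on m (cube M) ->
  gauss_mixture m = gmix clamp m.
Proof.
move=> mM; apply/funext => x.
have pdfE u : std_gauss_pdf (sub_tuple x u) = ((gconst d 1)^-1 * gweight x) * gkernel 1 x u.
  have pi20 : 0 <= 2 * pi :> R by rewrite mulr_ge0// pi_ge0.
  have normE : norm2 (sub_tuple x u) ^+ 2 = dotp x x - 2 * dotp x u + dotp u u.
    rewrite sqr_sqrtr; last by apply: sumr_ge0 => i _; exact: sqr_ge0.
    rewrite mulr_sumr -sumrB -big_split/=; apply: eq_bigr => i _.
    by rewrite tnth_mktuple; ring.
  rewrite /std_gauss_pdf normE -mulrA -expRD; congr (_ * expR _); last by field.
  by rewrite powRN [d%:R / 2]mulrC powRrM powR12_sqrt// powR_mulrn ?sqrtr_ge0// /gconst divr1.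
have ik := integrable_gkernel measurable_clamp clamp_le M0 m x.
transitivity (\int[m]_u ((gconst d 1)^-1 * gweight x * gkernel 1 x (clamp u))); last first.
  exact: RintegralZl.
have mk : measurable_fun setT (fun u => gkernel (d := d) 1 x u).
  apply: measurable_expR_comp; apply: measurable_funB.
    by apply: measurable_funM => //; apply: measurable_dotp => //; exact: measurable_id.
  by apply: measurable_funM => //; apply: measurable_dotp => //; exact: measurable_id.
rewrite /gauss_mixture /Rintegral; congr fine; apply: ae_eq_integral => //.
- under eq_fun do rewrite pdfE.
  by apply/measurable_EFinP; exact: measurable_funM.
- apply/measurable_EFinP; apply: measurable_funM => //.
  exact: (measurableT_comp mk measurable_clamp).
exists (~` cube M); split; first by apply: measurableC; exact: measurable_cube.
  have e := probability_setC m measurable_cube.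
  by apply: (etrans e); rewrite (mM : m (cube M) = 1%E) subee.
move=> u /= h uM; apply: h => _; rewrite pdfE clamp_id//.
Qed.

End clamp.

(** * Conclusion *)

(** For the case of vanishing total variation: $L^N/N!$ tends to 0. *)
Lemma le0_of_taylor_remainder (R : realType) (B L h : R) : 0 <= L ->
  (forall N, h <= B * Num.sqrt (L ^+ N.+1 / N.+1`!%:R)) -> h <= 0.
Proof.
move=> L0 hN.
have cv : (fun N => B * Num.sqrt (exp_coeff L N.+1)) @ \oo --> B * Num.sqrt 0.
  have c0 : exp_coeff L N.+1 @[N --> \oo] --> (0 : R).
    by have := cvg_exp_coeff L; rewrite -cvg_shiftS.
  have cs : Num.sqrt (exp_coeff L N.+1) @[N --> \oo] --> Num.sqrt (0 : R).
    by apply: continuous_cvg => //; exact: sqrt_continuous.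
  apply: cvgM cs; exact: cvg_cst.
rewrite sqrtr0 mulr0 in cv.
rewrite -(cvg_lim _ cv)//; apply: limr_ge; first by apply/cvg_ex; exists 0.
by near=> N; exact: hN.
Unshelve. all: by end_near.
Qed.

Theorem corollary2p4 (R : realType) (d : nat) (M delta : R) :
  (1 <= d)%N -> 0 < M -> 0 < delta ->
  exists C0 : R, 0 < C0 /\
    forall P Q : probability (d.-tuple R) R,
      supported_on P (cube M) -> supported_on Q (cube M) ->
      let t := TV (gauss_mixture P) (gauss_mixture Q) in
      hellinger (gauss_mixture P) (gauss_mixture Q) <=
        Num.max C0 (t `^ (- alpha delta t)) * t.
Proof.
move=> _ M0 delta0; have M0' := ltW M0.
pose eta := delta / (8 + 2 * delta).
have eta0 : 0 < eta by rewrite divr_gt0// addr_gt0// mulr_gt0.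
have [r [A [B [L [r01 A0 B0 L0 H]]]]] := genergy_bound d M0' eta0.
have /andP[r0 r1] := r01.
pose c := Num.sqrt (hellinger_const d M r) + 1.
have c0 : 0 < c by rewrite ltr_wpDl ?sqrtr_ge0.
have A20 : 0 < c * A * 2 by rewrite !mulr_gt0.
have cB0 : 0 < c * B by rewrite mulr_gt0.
(* The factor 2 in the first constant arises because the $L^1$ distance is twice the total
   variation. *)
have [t0 t00 Ht] := taylor_degree A20 cB0 L0 delta0.
pose S := Num.sqrt (L ^+ 1 / 1`!%:R).
have S0 : 0 <= S by exact: sqrtr_ge0.
(* Covers [t >= t0] through degree [N = 0], where the remainder is at most [c * B * S / t0 * t]. *)
pose C0 := c * A * 2 + c * B * S / t0.
have C00 : 0 < C0 by rewrite ltr_wpDr// divr_ge0 ?mulr_ge0// ltW.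
exists C0; split=> // P Q PM QM; pose t := TV (gauss_mixture P) (gauss_mixture Q).
pose h := hellinger (gauss_mixture P) (gauss_mixture Q).
suff : h <= Num.max C0 (t `^ (- alpha delta t)) * t by [].
have tE : 2 * t = \int[lebesgue_tuple d]_x `|gdiff P Q (clamp M) x|.
  rewrite /t /TV mulrA mulfV// mul1r (gauss_mixtureE M0' PM) (gauss_mixtureE M0' QM).
  by apply: eq_Rintegral => x _; rewrite gmix_diff.
have t_ge0 : 0 <= t.
  by rewrite /t /TV mulr_ge0// Rintegral_ge0.
have hle N : h <= c * A * 2 * expR ((1 + eta) * N%:R) * t +
    c * B * Num.sqrt (L ^+ N.+1 / N.+1`!%:R).
  have := H P Q (clamp M) N (measurable_clamp M) (clamp_le M0'); rewrite -tE => HN.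
  apply: (@le_trans _ _ (c * Num.sqrt (genergy P Q (clamp M) r^-1))); last first.
    rewrite (le_trans (ler_wpM2l (ltW c0) HN))// le_eqVlt; apply/orP; left; apply/eqP.
    by ring.
  apply: (@le_trans _ _ (Num.sqrt (hellinger_const d M r * genergy P Q (clamp M) r^-1))).
    rewrite /h /hellinger (gauss_mixtureE M0' PM) (gauss_mixtureE M0' QM) ler_wsqrtr//.
    apply: le_trans (hellinger_gmix_le P Q (measurable_clamp M) (clamp_le M0') M0' r0 r1).
    by rewrite ler_piMl ?invf_le1 ?ler1n//; apply: Rintegral_ge0 => x _; exact: sqr_ge0.
  have hc0 : 0 <= hellinger_const d M r.
    have k0 := mehler_rate_gt0 r0 r1; have m0 := mehler_const_gt0 d r0 r1.
    have g1 : 0 < gconst d (1 : R) by exact: gconst_gt0.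
    have gk : 0 < gconst d (mehler_rate r) by exact: gconst_gt0.
    apply: mulr_ge0 (ltW gk); apply: mulr_ge0 (expR_ge0 _).
    by apply: mulr_ge0 (ltW m0); rewrite invr_ge0 ltW.
  rewrite sqrtrM//.
  by rewrite ler_wpM2r ?sqrtr_ge0// lerDl.
have [t00'|t_neq0] := eqVneq t 0.
  rewrite t00' mulr0; apply: (@le0_of_taylor_remainder R (c * B) L) => [|N]; first exact: ltW.
  by have := hle N; rewrite t00' mulr0 add0r.
have t_gt0 : 0 < t by rewrite lt_neqAle eq_sym t_neq0.
have [tt0|t0t] := ltP t t0.
  have [N HN] := Ht t t_gt0 tt0.
  rewrite (le_trans (hle N))// (le_trans HN)// ler_wpM2r//.
  by rewrite le_max lexx orbT.
rewrite (@le_trans _ _ (C0 * t))//; last by rewrite ler_wpM2r// le_max lexx.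
rewrite (le_trans (hle 0%N))// mulr0 expR0 mulr1 -/S /C0 [leRHS]mulrDl lerD2l.
rewrite -[leRHS]mulrA ler_peMr//; first by rewrite mulr_ge0// ltW.
by rewrite mulrC ler_pdivlMr ?mul1r.
Qed.
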